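(* For $\alpha\in[0,1]$ the following are equivalent: (1) $\alpha$ is $\emptyset'$-right-c.e.; (2) $\alpha=\limsup_n q_n$ for some computable sequence of rationals $(q_n)_{n\in\omega}$; (3) $\alpha=\inf_n r_n$ for some uniform sequence $(r_n)_{n\in\omega}$ of left-c.e. reals; (4) there is a left-c.e. semi-measure $\rho$ such that $\overline\rho=\alpha\cdot\lambda$, i.e., $\overline\rho(\sigma)=\alpha\cdot2^{-|\sigma|}$ for all strings $\sigma$.
   Context: $2^{<\omega}$ is the set of finite binary strings, $\preceq$ the prefix order, $\varepsilon$ the empty string; $\lambda$ is the uniform measure, $\lambda(\sigma)=2^{-|\sigma|}$. A real is $\emptyset'$-right-c.e. if it is the limit of a $\emptyset'$-computable non-increasing sequence of rationals; a real is left-c.e. if it is the limit of a computable non-decreasing sequence of rationals, and a sequence of left-c.e. reals is uniform if these approximations are given uniformly. A semi-measure is $\rho:2^{<\omega}\to[0,1]$ with $\rho(\varepsilon)=1$ and $\rho(\sigma)\ge\rho(\sigma0)+\rho(\sigma1)$; left-c.e. means its values are uniformly left-c.e. For a semi-measure $\rho$, $\overline\rho(\sigma)=\inf_{n\ge|\sigma|}\sum_{\tau\succeq\sigma,\,|\tau|=n}\rho(\tau)$. *)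

(* Defs.v *)
From HB Require Import structures.
From mathcomp Require Import all_boot all_order all_algebra.
From mathcomp Require Import all_classical all_reals.
From mathcomp Require Import ereal topology normedtype sequences.
Set Implicit Arguments. Unset Strict Implicit. Unset Printing Implicit Defensive.
Import Order.TTheory GRing.Theory Num.Theory numFieldNormedType.Exports.

Definition cpair (x y : nat) : nat := (((x + y) * (x + y).+1)./2 + y)%N.

Inductive prog : Type :=
  | PZero | PSucc | PId | PFst | PSnd | POrac
  | PPair (f g : prog)
  | PComp (f g : prog)
  | PPrim (f g : prog)
  | PMu (f : prog).

Inductive eval (A : nat -> Prop) : prog -> nat -> nat -> Prop :=
  | eZero x : eval A PZero x 0
  | eSucc x : eval A PSucc x x.+1
  | eId x : eval A PId x x
  | eFst x y : eval A PFst (cpair x y) x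
  | eSnd x y : eval A PSnd (cpair x y) y
  | eOracT x : A x -> eval A POrac x 1
  | eOracF x : ~ A x -> eval A POrac x 0
  | ePair f g x a b : eval A f x a -> eval A g x b -> eval A (PPair f g) x (cpair a b)
  | eComp f g x y z : eval A g x y -> eval A f y z -> eval A (PComp f g) x z
  | ePrim0 f g x a : eval A f x a -> eval A (PPrim f g) (cpair x 0) a
  | ePrimS f g x n a b : eval A (PPrim f g) (cpair x n) a ->
      eval A g (cpair x (cpair n a)) b -> eval A (PPrim f g) (cpair x n.+1) b
  | eMu f x n : eval A f (cpair x n) 0 ->
      (forall m, (m < n)%N -> exists k, eval A f (cpair x m) k.+1) ->
      eval A (PMu f) x n.

Definition empty_oracle : nat -> Prop := fun _ => False.

Fixpoint code (p : prog) : nat :=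
  match p with
  | PZero => cpair 0 0 | PSucc => cpair 1 0 | PId => cpair 2 0
  | PFst => cpair 3 0 | PSnd => cpair 4 0 | POrac => cpair 5 0
  | PPair f g => cpair 6 (cpair (code f) (code g))
  | PComp f g => cpair 7 (cpair (code f) (code g))
  | PPrim f g => cpair 8 (cpair (code f) (code g))
  | PMu f => cpair 9 (code f)
  end.

Definition halting_set : nat -> Prop :=
  fun e => exists p, code p = e /\ exists y, eval empty_oracle p e y.

Definition computable_in (A : nat -> Prop) (f : nat -> nat) : Prop :=
  exists p, forall x, eval A p x (f x).

Definition computable (f : nat -> nat) : Prop := computable_in empty_oracle f.

Definition rat_of_nats (a b c : nat) : rat := (a%:R - b%:R) / (c.+1)%:R.

Definition ratseq_computable_in (A : nat -> Prop) (q : nat -> rat) : Prop :=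
  exists f g h : nat -> nat,
    [/\ computable_in A f, computable_in A g, computable_in A h &
        forall n, q n = rat_of_nats (f n) (g n) (h n)].

Definition ratseq_computable (q : nat -> rat) : Prop :=
  ratseq_computable_in empty_oracle q.

Definition ratseq2_computable (q : nat -> nat -> rat) : Prop :=
  exists q' : nat -> rat, ratseq_computable q' /\
    forall m n, q m n = q' (cpair m n).

Local Open Scope ring_scope.
Local Open Scope classical_set_scope.

Definition jump_right_ce (R : realType) (a : R) : Prop :=
  exists q : nat -> rat, ratseq_computable_in halting_set q /\
    (forall n, q n.+1 <= q n) /\ (ratr (q n) : R) @[n --> \oo] --> a.

Definition uniform_left_ce (R : realType) (r : nat -> R) : Prop :=
  exists q : nat -> nat -> rat, ratseq2_computable q /\
    forall m, (forall n, q m n <= q m n.+1) /\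
              (ratr (q m n) : R) @[n --> \oo] --> r m.

(* injective coding of binary strings: the number with binary digits 1 sigma *)
Definition str_code (s : seq bool) : nat :=
  foldl (fun a (b : bool) => (a.*2 + b)%N) 1%N s.

Definition semimeasure (R : realType) (rho : seq bool -> R) : Prop :=
  [/\ forall s, 0 <= rho s <= 1, rho [::] = 1 &
      forall s, rho (rcons s false) + rho (rcons s true) <= rho s].

Definition left_ce_semimeasure (R : realType) (rho : seq bool -> R) : Prop :=
  semimeasure rho /\
  exists q : seq bool -> nat -> rat,
    (exists q' : nat -> rat, ratseq_computable q' /\
       forall s n, q s n = q' (cpair (str_code s) n)) /\
    forall s, (forall n, q s n <= q s n.+1) /\
              (ratr (q s n) : R) @[n --> \oo] --> rho s.

Definition rhobar (R : realType) (rho : seq bool -> R) (s : seq bool) : R :=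
  inf [set (\sum_(t : n.-tuple bool | prefix s t) rho t)
      | n in [set n : nat | (size s <= n)%N]].

(* Main.v *)
(* (1) => (2): approximating the halting set by its finite stages and running the
   oracle program on the approximation gives a computable g(i, s) whose limit in
   s is the code of q_i.  At stage s one outputs the minimum of 1 and of the
   current values below the first index that changes between s and s + 1; this
   is eventually below every q_i, and at "true" stages, where those values are
   already final, it is at least alpha.
   (2) => (3): take r_n = sup_(m >= n) q_m.
   (3) => (4): take rho(s) = 2^-|s| min(1, r_0, ..., r_(|s|-1)).
   (4) => (1): for S_n the rho-mass of the strings of length n, the oracle finds
   the least k with S_n <= k/(j+1), and alpha is the infimum of these rationals
   over all n and j.
   That the halting set is recursively enumerable is shown with certificates:
   lists of judgements "c is the code of a program" and "c maps x to y", each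
   following from later entries of the list by one rule of [eval]. *)
Require Import Defs.
From HB Require Import structures.
From mathcomp Require Import all_boot all_order all_algebra.
From mathcomp Require Import all_classical all_reals.
From mathcomp Require Import ereal topology normedtype sequences.
From mathcomp Require Import zify ring lra.
Import Order.TTheory GRing.Theory Num.Theory numFieldNormedType.Exports.
Local Open Scope ring_scope.
Local Open Scope classical_set_scope.
Set Implicit Arguments. Unset Strict Implicit. Unset Printing Implicit Defensive.
Local Notation eval := Defs.eval.
Local Notation code := Defs.code.

(** * Pairing *)

Section Pairing.
Local Open Scope nat_scope.

Lemma half_mulS n : (n.+1 * n.+2)./2 = (n * n.+1)./2 + n.+1.
Proof.
have -> : n.+1 * n.+2 = n * n.+1 + n.+1.*2 by lia.
by rewrite halfD odd_double andbF doubleK.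
Qed.

Lemma cpair0S y : cpair y.+1 0 = (cpair 0 y).+1.
Proof. by rewrite /cpair !addn0 !add0n half_mulS; lia. Qed.

Lemma cpairSr x y : cpair x y.+1 = (cpair x.+1 y).+1.
Proof. by rewrite /cpair addnS addSn addnS. Qed.

Lemma half_mulS_mono m n : m <= n -> (m * m.+1)./2 <= (n * n.+1)./2.
Proof. by move=> mn; apply: half_leq; rewrite leq_mul. Qed.

Lemma leq_cpairl x y : x <= cpair x y.
Proof.
apply: leq_trans (leq_addr _ _); apply: leq_trans (leq_addr y x) _.
by case: (x + y) => // n; rewrite half_mulS leq_addl.
Qed.

Lemma leq_cpairr x y : y <= cpair x y.
Proof. exact: leq_addl. Qed.

(** If the sums [x + y] and [x' + y'] agree, the triangular parts cancel. If the first sum is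
    smaller, the next triangular number already exceeds [cpair x y], because [y <= x + y]. *)
Lemma cpair_inj x y x' y' : cpair x y = cpair x' y' -> x = x' /\ y = y'.
Proof.
wlog le_s : x y x' y' / x + y <= x' + y' => [hw|].
  case/orP: (leq_total (x + y) (x' + y')) => le_s E; first exact: hw.
  by have [-> ->] := hw _ _ _ _ le_s (esym E).
rewrite /cpair; have [es|] := eqVneq (x + y) (x' + y').
  by rewrite es => /addnI ey; move: es; rewrite ey => /addIn.
move=> ne; have lt_s : x + y < x' + y' by rewrite ltn_neqAle ne.
by have := half_mulS_mono lt_s; rewrite half_mulS; lia.
Qed.

(** Successive codes are successive points along the antidiagonals, so the inverse of [cpair] is
    reached by moving one point per recursive step. *)
Fixpoint unpair n : nat * nat :=
  if n is m.+1 then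
    let: (x, y) := unpair m in if x is x'.+1 then (x', y.+1) else (y.+1, 0)
  else (0, 0).
Definition cfst n := (unpair n).1.
Definition csnd n := (unpair n).2.

Lemma cfst_csndK n : cpair (cfst n) (csnd n) = n.
Proof.
rewrite /cfst /csnd; elim: n => //= n; case: (unpair n) => [[|x] y] /= <-.
  exact: cpair0S.
exact: cpairSr.
Qed.

Lemma cpairK1 x y : cfst (cpair x y) = x.
Proof. by have [] := cpair_inj (cfst_csndK (cpair x y)). Qed.

Lemma cpairK2 x y : csnd (cpair x y) = y.
Proof. by have [] := cpair_inj (cfst_csndK (cpair x y)). Qed.

Definition cpairK := (cpairK1, cpairK2, cfst_csndK).

Lemma leq_csnd n : csnd n <= n.
Proof. by rewrite -{2}(cfst_csndK n) leq_cpairr. Qed.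

End Pairing.
Opaque cpair.

(** * Programs *)

Section Programs.
Local Open Scope nat_scope.
Variable A : nat -> Prop.

Lemma evalPairE f g x y : eval A (PPair f g) x y ->
  exists a b, [/\ eval A f x a, eval A g x b & y = cpair a b].
Proof. by inversion 1; exists a, b. Qed.

Lemma evalCompE f g x z : eval A (PComp f g) x z ->
  exists y, eval A g x y /\ eval A f y z.
Proof. by inversion 1; exists y. Qed.

Lemma evalFstE x y : eval A PFst x y -> y = cfst x.
Proof. by inversion 1; rewrite cpairK. Qed.

Lemma evalSndE x y : eval A PSnd x y -> y = csnd x.
Proof. by inversion 1; rewrite cpairK. Qed.

Lemma evalFst x : eval A PFst x (cfst x).
Proof. by rewrite -{1}(cfst_csndK x); constructor. Qed.

Lemma evalSnd x : eval A PSnd x (csnd x).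
Proof. by rewrite -{1}(cfst_csndK x); constructor. Qed.

Lemma evalPrim0E f g x y : eval A (PPrim f g) (cpair x 0) y -> eval A f x y.
Proof.
(* The argument becomes a variable before inversion, which cannot solve equations between values of
   [cpair]; [cpair_inj] then rules out the successor rule. *)
move E: (cpair x 0) => z e; move: E; inversion e; subst => E.
  by case: (cpair_inj E) => ->.
by case: (cpair_inj E).
Qed.

Lemma evalPrimSE f g x n y : eval A (PPrim f g) (cpair x n.+1) y ->
  exists a, eval A (PPrim f g) (cpair x n) a
          /\ eval A g (cpair x (cpair n a)) y.
Proof.
move E: (cpair x n.+1) => z e; move: E; inversion e; subst => E.
  by case: (cpair_inj E).
by case: (cpair_inj E) => -> [->]; exists a.
Qed.

Lemma evalMuE f x n : eval A (PMu f) x n ->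
  eval A f (cpair x n) 0 /\
  (forall m, m < n -> exists k, eval A f (cpair x m) k.+1).
Proof. by inversion 1. Qed.

(** Induction on the program, with an inner induction on the counter for [PPrim]. For [PMu], if the
    two results differed, the body would take both the value 0 and a positive value at the smaller
    one. *)
Lemma eval_det p x y y' : eval A p x y -> eval A p x y' -> y = y'.
Proof.
elim: p x y y' => [||||||f IHf g IHg|f IHf g IHg|f IHf g IHg|f IHf] x y y'.
- by inversion 1; inversion 1.
- by inversion 1; inversion 1.
- by inversion 1; subst; inversion 1.
- by move=> /evalFstE -> /evalFstE.
- by move=> /evalSndE -> /evalSndE.
- by inversion 1; inversion 1.
- move=> /evalPairE[a [b [ea eb ->]]] /evalPairE[a' [b' [ea' eb' ->]]].
  by rewrite (IHf _ _ _ ea ea') (IHg _ _ _ eb eb').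
- move=> /evalCompE[a [ea eb]] /evalCompE[a' [ea' eb']].
  by rewrite (IHg _ _ _ ea ea') in eb; exact: IHf eb eb'.
- rewrite -(cfst_csndK x); move: (cfst x) (csnd x) => {}x n.
  elim: n y y' => [|n IHn] y y'.
    by move=> /evalPrim0E e /evalPrim0E; exact: IHf e.
  move=> /evalPrimSE[a [ea eb]] /evalPrimSE[a' [ea' eb']].
  by rewrite (IHn _ _ ea ea') in eb; exact: IHg eb eb'.
- move=> /evalMuE[e0 lt] /evalMuE[e0' lt'].
  case: (ltngtP y y') => // [/lt'[k ek]|/lt[k ek]].
    by have := IHf _ _ _ e0 ek.
  by have := IHf _ _ _ e0' ek.
Qed.

End Programs.

Lemma code_inj : injective code.
Proof.
elim=> [||||||f IHf g IHg|f IHf g IHg|f IHf g IHg|f IHf]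
  [||||||f' g'|f' g'|f' g'|f'] //= /cpair_inj[] // _.
- by case/cpair_inj=> /IHf-> /IHg->.
- by case/cpair_inj=> /IHf-> /IHg->.
- by case/cpair_inj=> /IHf-> /IHg->.
- by move/IHf->.
Qed.

(** * Closure properties of the computable functions *)

Fixpoint natrec (b : nat) (st : nat -> nat -> nat) (n : nat) : nat :=
  if n is m.+1 then st m (natrec b st m) else b.

(** Bounded search, with default value [n] when nothing below [n] satisfies [P]. *)
Definition bmu (P : nat -> bool) n := find P (iota 0 n).
Definition bex (P : nat -> bool) n := has P (iota 0 n).
Definition ball (P : nat -> bool) n := all P (iota 0 n).

Section Closure.
Local Open Scope nat_scope.
Variable A : nat -> Prop.
Implicit Types (f g h : nat -> nat) (P Q : nat -> bool).

Lemma comp_ext f g : f =1 g -> computable_in A f -> computable_in A g.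
Proof. by move=> /funext ->. Qed.

Lemma comp_const c : computable_in A (fun=> c).
Proof.
elim: c => [|c [p hp]]; first by exists PZero => x; constructor.
by exists (PComp PSucc p) => x; econstructor; [exact: hp|constructor].
Qed.

Lemma comp_id : computable_in A (fun x => x).
Proof. by exists PId; constructor. Qed.

Lemma comp_comp f g : computable_in A f -> computable_in A g ->
  computable_in A (fun x => f (g x)).
Proof. by move=> [p hp] [q hq]; exists (PComp p q) => x; econstructor. Qed.

Lemma comp_S f : computable_in A f -> computable_in A (fun x => (f x).+1).
Proof. by apply: comp_comp; exists PSucc; constructor. Qed.

Lemma comp_fst f : computable_in A f -> computable_in A (fun x => cfst (f x)).
Proof. by apply: comp_comp; exists PFst; exact: evalFst. Qed.

Lemma comp_snd f : computable_in A f -> computable_in A (fun x => csnd (f x)).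
Proof. by apply: comp_comp; exists PSnd; exact: evalSnd. Qed.

Lemma comp_pair f g : computable_in A f -> computable_in A g ->
  computable_in A (fun x => cpair (f x) (g x)).
Proof. by move=> [p hp] [q hq]; exists (PPair p q) => x; constructor. Qed.

(** [PPrim] works on pairs of a parameter and a counter, so the recursion is first computed on pairs
    and then composed with the map from [x] to [cpair x (n x)]. *)
Lemma comp_rec b (st : nat -> nat -> nat -> nat) n :
  computable_in A b ->
  computable_in A (fun z => st (cfst z) (cfst (csnd z)) (csnd (csnd z))) ->
  computable_in A n -> computable_in A (fun x => natrec (b x) (st x) (n x)).
Proof.
move=> [pb hb] [ps hs] cn.
suff cr : computable_in A (fun z => natrec (b (cfst z)) (st (cfst z)) (csnd z)).
  by apply: comp_ext (comp_comp cr (comp_pair comp_id cn)) => x; rewrite !cpairK.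
exists (PPrim pb ps) => z; rewrite -{1}(cfst_csndK z).
elim: (csnd z) => [|k IHk]; first by constructor.
apply: (ePrimS IHk).
move: (hs (cpair (cfst z) (cpair k (natrec (b (cfst z)) (st (cfst z)) k)))).
by rewrite !cpairK.
Qed.

Lemma comp_app2 (F : nat -> nat -> nat) f g :
  computable_in A (fun z => F (cfst z) (csnd z)) ->
  computable_in A f -> computable_in A g ->
  computable_in A (fun x => F (f x) (g x)).
Proof.
move=> cF cf cg; apply: comp_ext (comp_comp cF (comp_pair cf cg)) => x.
by rewrite !cpairK.
Qed.

Lemma comp_pred f : computable_in A f -> computable_in A (fun x => (f x).-1).
Proof.
move=> cf; apply: (@comp_ext (fun x => natrec 0 (fun m _ => m) (f x))).
  by move=> x; case: (f x).
by apply: comp_rec => //; [exact: comp_const|apply/comp_fst/comp_snd/comp_id].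
Qed.

Lemma comp_add f g : computable_in A f -> computable_in A g ->
  computable_in A (fun x => f x + g x).
Proof.
move=> cf cg; apply: (@comp_ext (fun x => natrec (f x) (fun _ a => a.+1) (g x))).
  by move=> x; elim: (g x) => [|n /= ->]; rewrite ?addn0 ?addnS.
by apply: comp_rec => //; apply/comp_S/comp_snd/comp_snd/comp_id.
Qed.

Lemma comp_sub f g : computable_in A f -> computable_in A g ->
  computable_in A (fun x => f x - g x).
Proof.
move=> cf cg; apply: (@comp_ext (fun x => natrec (f x) (fun _ a => a.-1) (g x))).
  by move=> x; elim: (g x) => [|n /= ->]; rewrite ?subn0 ?subnS.
by apply: comp_rec => //; apply/comp_pred/comp_snd/comp_snd/comp_id.
Qed.

Lemma comp_mul f g : computable_in A f -> computable_in A g ->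
  computable_in A (fun x => f x * g x).
Proof.
move=> cf cg.
apply: (@comp_ext (fun x => natrec 0 (fun _ a => a + f x) (g x))).
  by move=> x; elim: (g x) => [|n /= ->]; rewrite ?muln0 // mulnS addnC.
apply: (@comp_rec _ (fun x _ a => a + f x)) => //; first exact: comp_const.
apply: comp_add; first exact/comp_snd/comp_snd/comp_id.
exact: (comp_comp cf (comp_fst comp_id)).
Qed.

Lemma comp_ite P f g : computable_in A P -> computable_in A f ->
  computable_in A g -> computable_in A (fun x => if P x then f x else g x).
Proof.
move=> cP cf cg.
apply: (@comp_ext (fun x => natrec (g x) (fun _ _ => f x) (P x))).
  by move=> x; case: (P x).
apply: (@comp_rec _ (fun x _ _ => f x)) => //.
exact: (comp_comp cf (comp_fst comp_id)).
Qed.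

Lemma comp_leq f g : computable_in A f -> computable_in A g ->
  computable_in A (fun x => f x <= g x).
Proof.
move=> cf cg; apply: (@comp_ext (fun x => 1 - (f x - g x))).
  by move=> x; rewrite -subn_eq0; case: (f x - g x) => //= n; rewrite subSS.
by apply: comp_sub; [exact: comp_const|exact: comp_sub].
Qed.

Lemma comp_andb P Q : computable_in A P -> computable_in A Q ->
  computable_in A (fun x => P x && Q x).
Proof.
by move=> cP cQ; apply: comp_ext (comp_mul cP cQ) => x; rewrite mulnb.
Qed.

Lemma comp_negb P : computable_in A P -> computable_in A (fun x => ~~ P x).
Proof.
move=> cP; apply: comp_ext (comp_sub (comp_const 1) cP) => x.
by case: (P x).
Qed.

Lemma comp_orb P Q : computable_in A P -> computable_in A Q ->
  computable_in A (fun x => P x || Q x).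
Proof.
move=> cP cQ; apply: comp_ext (comp_negb (comp_andb (comp_negb cP) (comp_negb cQ))) => x.
by rewrite negb_and !negbK.
Qed.

Lemma comp_ifb P Q (S : nat -> bool) : computable_in A P -> computable_in A Q ->
  computable_in A S -> computable_in A (fun x => if P x then Q x else S x).
Proof.
move=> cP cQ cS; apply: comp_ext (comp_ite cP cQ cS) => x.
by case: (P x).
Qed.

Lemma comp_eqn f g : computable_in A f -> computable_in A g ->
  computable_in A (fun x => f x == g x).
Proof.
move=> cf cg; apply: comp_ext (comp_andb (comp_leq cf cg) (comp_leq cg cf)) => x.
by rewrite eqn_leq.
Qed.

Lemma comp_oracle f P : (forall x, A x <-> P x) -> computable_in A f ->
  computable_in A (fun x => P (f x)).
Proof.
move=> AP; apply: (@comp_comp P); exists POrac => x.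
by case: (boolP (P x)) => [/AP|/negP nP] /=; constructor => //; rewrite AP.
Qed.

(** As [F] is total, its nonzero values below [f x] supply the positive values that [eMu] demands at
    every earlier argument. *)
Lemma comp_mu (F : nat -> nat -> nat) f :
  computable_in A (fun z => F (cfst z) (csnd z)) ->
  (forall x, F x (f x) = 0 /\ forall m, m < f x -> F x m <> 0) ->
  computable_in A f.
Proof.
move=> [p hp] hf; exists (PMu p) => x; have [F0 Fpos] := hf x.
have e m : eval A p (cpair x m) (F x m) by have := hp (cpair x m); rewrite !cpairK.
constructor; first by have := e (f x); rewrite F0.
move=> m /Fpos /eqP nz; exists (F x m).-1; rewrite prednK ?lt0n //.
Qed.

(** The accumulator [a] at step [m] is [bmu P m]: either [a < m] and a witness has been found, or
    [a = m] and [P a] tests the next candidate. *)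
Lemma bmu_rec P n :
  bmu P n = natrec 0 (fun m a => if (a < m) || P a then a else m.+1) n.
Proof.
elim: n => //= n <-; rewrite /bmu -[n.+1]addn1 iotaD find_cat /= add0n size_iota.
have /= := has_find P (iota 0 n); rewrite size_iota => ->.
case: ltnP => //= h; have := find_size P (iota 0 n); rewrite size_iota => h'.
have -> : find P (iota 0 n) = n by apply/eqP; rewrite eqn_leq h h'.
by case: (P n); rewrite ?addn0 ?addn1.
Qed.

Lemma comp_bmu (P : nat -> nat -> bool) n :
  computable_in A (fun z => P (cfst z) (csnd z)) -> computable_in A n ->
  computable_in A (fun x => bmu (P x) (n x)).
Proof.
move=> cP cn.
apply: (@comp_ext (fun x => natrec 0 (fun m a => if (a < m) || P x a then a else m.+1) (n x))).
  by move=> x; rewrite bmu_rec.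
apply: (@comp_rec _ (fun x m a => if (a < m) || P x a then a else m.+1)) => //.
  exact: comp_const.
have c1 : computable_in A (fun z => cfst (csnd z)) by apply/comp_fst/comp_snd/comp_id.
have c2 : computable_in A (fun z => csnd (csnd z)) by apply/comp_snd/comp_snd/comp_id.
apply: comp_ite; [|by []|exact: comp_S].
apply: comp_orb; first by apply: comp_leq => //; exact: comp_S.
by apply: (@comp_app2 P) => //; apply/comp_fst/comp_id.
Qed.

Lemma comp_bex (P : nat -> nat -> bool) n :
  computable_in A (fun z => P (cfst z) (csnd z)) -> computable_in A n ->
  computable_in A (fun x => bex (P x) (n x)).
Proof.
move=> cP cn.
have := comp_leq (comp_S (comp_bmu cP cn)) cn.
by apply: comp_ext => x; rewrite /bex has_find size_iota.
Qed.

Lemma comp_ball (P : nat -> nat -> bool) n :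
  computable_in A (fun z => P (cfst z) (csnd z)) -> computable_in A n ->
  computable_in A (fun x => ball (P x) (n x)).
Proof.
move=> cP cn.
apply: (@comp_ext (fun x => ~~ bex (fun m => ~~ P x m) (n x))).
  move=> x; rewrite /bex /ball -all_predC; congr nat_of_bool.
  by apply: eq_all => m /=; rewrite negbK.
by apply/comp_negb/(comp_bex (P := fun x m => ~~ P x m))/cn/comp_negb.
Qed.

Lemma bexP P n : reflect (exists i, i < n /\ P i) (bex P n).
Proof.
apply: (iffP hasP) => [[i]|[i [lt Pi]]]; last by exists i => //; rewrite mem_iota.
by rewrite mem_iota => lt Pi; exists i.
Qed.

Lemma ballP P n : reflect (forall i, i < n -> P i) (ball P n).
Proof.
apply: (iffP allP) => [h i lt|h i]; first by apply: h; rewrite mem_iota.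
by rewrite mem_iota; exact: h.
Qed.

Lemma comp_pow2 f : computable_in A f -> computable_in A (fun x => 2 ^ f x).
Proof.
move=> cf; apply: (@comp_ext (fun x => natrec 1 (fun _ a => a + a) (f x))).
  by move=> x; elim: (f x) => //= n ->; rewrite expnS mul2n addnn.
apply: comp_rec => //; first exact: comp_const.
by apply: comp_add; apply/comp_snd/comp_snd/comp_id.
Qed.

End Closure.

(** * Properties of bounded search *)

Section BoundedSearch.
Local Open Scope nat_scope.

Lemma bmuE (P : nat -> bool) n k : k < n -> P k -> (forall i, i < k -> ~~ P i) -> bmu P n = k.
Proof.
move=> lt_kn Pk nP; rewrite /bmu (_ : n = k + (n - k).-1.+1); last by lia.
rewrite iotaD find_cat /= Pk addn0 size_iota ifN //.
by apply/hasPn => i; rewrite mem_iota => /nP.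
Qed.

Lemma bmuN (P : nat -> bool) n i : i < bmu P n -> ~~ P i.
Proof.
move=> lt_i; have lt_n := leq_trans lt_i (find_size P (iota 0 n)).
have := before_find 0 lt_i; rewrite nth_iota ?add0n; last by rewrite size_iota in lt_n.
by move=> ->.
Qed.

Lemma bmu_gt (P : nat -> bool) n k : k < n -> (forall i, i <= k -> ~~ P i) -> k < bmu P n.
Proof.
move=> lt_k nP; rewrite ltnNge; apply/negP => le_k.
have lt_n : bmu P n < n by exact: leq_ltn_trans lt_k.
have := nP _ le_k; rewrite -[bmu P n]add0n -(nth_iota 0 0 lt_n) nth_find //.
by rewrite has_find size_iota.
Qed.

End BoundedSearch.

(** * Computable functions relative to an arbitrary oracle *)

Section Relativization.
Local Open Scope nat_scope.

Fixpoint without_oracle (p : prog) : prog :=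
  match p with
  | POrac => PZero
  | PPair f g => PPair (without_oracle f) (without_oracle g)
  | PComp f g => PComp (without_oracle f) (without_oracle g)
  | PPrim f g => PPrim (without_oracle f) (without_oracle g)
  | PMu f => PMu (without_oracle f)
  | _ => p
  end.

(** The empty oracle always answers 0, so [PZero] can stand for [POrac], and the resulting program
    asks no questions of [A]. *)
Lemma eval_without_oracle A p x y :
  eval empty_oracle p x y -> eval A (without_oracle p) x y.
Proof.
elim: p x y => [||||||f IHf g IHg|f IHf g IHg|f IHf g IHg|f IHf] x y /=.
- by inversion 1; constructor.
- by inversion 1; constructor.
- by inversion 1; constructor.
- by inversion 1; constructor.
- by inversion 1; constructor.
- by inversion 1 => //; constructor.
- by move=> /evalPairE[a [b [/IHf ea /IHg eb ->]]]; constructor.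
- by move=> /evalCompE[a [/IHg ea /IHf eb]]; econstructor; eassumption.
- rewrite -(cfst_csndK x); move: (cfst x) (csnd x) => {}x n.
  elim: n y => [|n IHn] y; first by move=> /evalPrim0E/IHf; constructor.
  by move=> /evalPrimSE[a [/IHn ea /IHg eb]]; apply: ePrimS ea eb.
- move=> /evalMuE[/IHf e0 lt]; constructor=> // m /lt[k /IHf ek].
  by exists k.
Qed.

Lemma computable_relative A f : computable f -> computable_in A f.
Proof.
by case=> p hp; exists (without_oracle p) => x; exact: eval_without_oracle.
Qed.

End Relativization.

(** The head symbol of the function body selects the closure lemma; second-order patterns recover
    the predicate under a bounded quantifier or the step of a recursion. *)
Ltac computability := repeat (cbv beta; first
 [ assumption
 | lazymatch goal with
   | |- computable_in _ cfst => exact: (comp_fst (comp_id _))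
   | |- computable_in _ csnd => exact: (comp_snd (comp_id _))
   | |- computable_in _ S => exact: (comp_S (comp_id _))
   | |- computable_in _ (natrec ?b ?st) =>
       apply: (@comp_rec _ (fun=> b) (fun=> st) (fun x => x))
   | |- computable_in _ predn => exact: (comp_pred (comp_id _))
   | |- computable_in _ (fun x => x) => apply: comp_id
   | |- computable_in _ (fun=> ?c) => apply: comp_const
   | |- computable_in _ (fun x => S _) => apply: comp_S
   | |- computable_in _ (fun x => cfst _) => apply: comp_fst
   | |- computable_in _ (fun x => csnd _) => apply: comp_snd
   | |- computable_in _ (fun x => predn _) => apply: comp_pred
   | |- computable_in _ (fun x => cpair _ _) => apply: comp_pair
   | |- computable_in _ (fun x => addn _ _) => apply: comp_add
   | |- computable_in _ (fun x => subn _ _) => apply: comp_sub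
   | |- computable_in _ (fun x => muln _ _) => apply: comp_mul
   | |- computable_in _ (fun x => nat_of_bool (andb _ _)) => apply: comp_andb
   | |- computable_in _ (fun x => nat_of_bool (orb _ _)) => apply: comp_orb
   | |- computable_in _ (fun x => nat_of_bool (negb _)) => apply: comp_negb
   | |- computable_in _ (fun x => nat_of_bool (leq _ _)) => apply: comp_leq
   | |- computable_in _ (fun x => nat_of_bool (eq_op _ _)) => apply: comp_eqn
   | |- computable_in _ (fun x => nat_of_bool (if _ then _ else _)) => apply: comp_ifb
   | |- computable_in _ (fun x => if _ then _ else _) => apply: comp_ite
   | |- computable_in _ (fun x => nat_of_bool (bex (fun i => @?P x i) _)) => apply: (@comp_bex _ P)
   | |- computable_in _ (fun x => nat_of_bool (ball (fun i => @?P x i) _)) => apply: (@comp_ball _ P)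
   | |- computable_in _ (fun x => bmu (fun i => @?P x i) _) => apply: (@comp_bmu _ P)
   | |- computable_in _ (fun x => natrec _ (fun n a => @?P x n a) _) => apply: (@comp_rec _ _ P)
   | H : computable_in _ ?f |- computable_in _ (fun x => ?f _) => apply: (comp_comp H)
   end ]).

(** * The halting set is recursively enumerable *)

Section Certificates.
Local Open Scope nat_scope.

(** Lists are coded as in [lcode] below: 0 is the empty list, and [(cpair z w).+1] has head [z] and
    tail [w]. The tail of 0 is again 0, so running past the end stays at the empty list. *)
Definition suffix (w i : nat) := natrec w (fun _ a => csnd a.-1) i.

(** A list is never longer than its code, which makes [w] a sufficient bound for the position. *)
Definition memn (w z : nat) : bool :=
  bex (fun i => (0 < suffix w i) && (cfst (suffix w i).-1 == z)) w.

Lemma comp_suffix A f g : computable_in A f -> computable_in A g ->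
  computable_in A (fun x => suffix (f x) (g x)).
Proof. by move=> cf cg; rewrite /suffix; computability. Qed.

Lemma comp_memn A f g : computable_in A f -> computable_in A g ->
  computable_in A (fun x => memn (f x) (g x)).
Proof.
move=> cf cg; apply: (@comp_app2 _ memn) => //; rewrite /memn.
by computability; apply: comp_suffix; computability.
Qed.

(* Judgements: [jcode c] says that [c] is the code of a program, and
   [jeval c x y] that moreover this program maps [x] to [y]. *)
Definition jcode c := cpair 0 c.
Definition jeval c x y := cpair 1 (cpair c (cpair x y)).

Definition just_code (w c : nat) : bool :=
  let t := cfst c in let a := csnd c in
  [|| (t <= 5) && (a == 0),
      [&& 6 <= t, t <= 8, memn w (jcode (cfst a)) & memn w (jcode (csnd a))]
    | (t == 9) && memn w (jcode a)].

(** The disjuncts follow the rules of [eval] for the empty oracle. The base rule of primitive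
    recursion does not run the step program, so a [jcode] premise certifies its code. The values
    searched for occur in judgements listed in [w] and are therefore below [w]. *)
Definition just_eval (w c x y : nat) : bool :=
  let t := cfst c in let a := csnd c in
  [|| [&& t == 0, a == 0 & y == 0],
      [&& t == 1, a == 0 & y == x.+1],
      [&& t == 2, a == 0 & y == x],
      [&& t == 3, a == 0 & y == cfst x],
      [&& t == 4, a == 0 & y == csnd x],
      [&& t == 5, a == 0 & y == 0],
      [&& t == 6, memn w (jeval (cfst a) x (cfst y))
        & memn w (jeval (csnd a) x (csnd y))],
      (t == 7) && bex (fun v => memn w (jeval (csnd a) x v)
                             && memn w (jeval (cfst a) v y)) w,
      [&& t == 8, csnd x == 0, memn w (jeval (cfst a) (cfst x) y)
        & memn w (jcode (csnd a))],
      [&& t == 8, 0 < csnd x & bex (fun v =>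
           memn w (jeval c (cpair (cfst x) (csnd x).-1) v)
        && memn w (jeval (csnd a) (cpair (cfst x) (cpair (csnd x).-1 v)) y)) w]
    | [&& t == 9, memn w (jeval a (cpair x y) 0) &
        ball (fun m => bex (fun k => memn w (jeval a (cpair x m) k.+1)) w) y]].

Definition just (w z : nat) : bool :=
  if cfst z == 0 then just_code w (csnd z)
  else (cfst z == 1) && just_eval w (cfst (csnd z))
         (cfst (csnd (csnd z))) (csnd (csnd (csnd z))).

Lemma comp_just A f g : computable_in A f -> computable_in A g ->
  computable_in A (fun x => just (f x) (g x)).
Proof.
move=> cf cg; apply: (@comp_app2 _ just) => //.
rewrite /just /just_code /just_eval /jcode /jeval.
by repeat (computability; try apply: comp_memn).
Qed.

Fixpoint lcode (l : seq nat) : nat :=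
  if l is z :: l' then (cpair z (lcode l')).+1 else 0.

Lemma suffix0 i : suffix 0 i = 0.
Proof. by rewrite /suffix; elim: i => //= i ->. Qed.

Lemma suffixS w i : suffix w i.+1 = suffix (csnd w.-1) i.
Proof. by rewrite /suffix; elim: i => //= i <-. Qed.

Lemma suffix_lcode l i : suffix (lcode l) i = lcode (drop i l).
Proof.
elim: l i => [|z l IHl] [|i] //; first exact: suffix0.
by rewrite suffixS /= cpairK IHl.
Qed.

Lemma size_lcode l : size l <= lcode l.
Proof. by elim: l => //= z l IHl; apply: leq_trans IHl (leq_cpairr _ _). Qed.

Lemma lcode_surj w : exists l, w = lcode l.
Proof.
elim/ltn_ind: w => [[|w]] IHw; first by exists [::].
by have [l El] := IHw (csnd w) (leq_csnd w); exists (cfst w :: l); rewrite /= -El cpairK.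
Qed.

Lemma memn_lcode l z : memn (lcode l) z = (z \in l).
Proof.
apply/bexP/idP => [[i [_ /andP[]]]|zl].
  rewrite suffix_lcode; case E: (drop i l) => [|z' l'] //= _.
  rewrite cpairK => /eqP <-; apply: (@mem_drop i).
  by rewrite E mem_head.
exists (index z l); split.
  by apply: leq_trans (size_lcode l); rewrite index_mem.
rewrite suffix_lcode (drop_nth 0) ?index_mem //= cpairK nth_index //.
Qed.

Lemma memn_lt w z : memn w z -> z < w.
Proof.
have [l ->] := lcode_surj w; rewrite memn_lcode.
elim: l => //= z' l IHl; rewrite inE => /predU1P[->|/IHl lt].
  by rewrite ltnS leq_cpairl.
by rewrite ltnS (leq_trans (ltnW lt)) // leq_cpairr.
Qed.

Lemma jeval_ge c x y : y <= jeval c x y.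
Proof. by rewrite /jeval; do 3 apply: leq_trans (leq_cpairr _ _). Qed.

(** The computable form of [valid l && (z \in l)] for the list [l] coded by [w]: the head of each
    nonempty suffix is justified by its tail. *)
Definition derived (w z : nat) : bool :=
  ball (fun i => (suffix w i == 0) || just (csnd (suffix w i).-1)
                                            (cfst (suffix w i).-1)) w
  && memn w z.

Fixpoint valid (l : seq nat) : bool :=
  if l is z :: l' then just (lcode l') z && valid l' else true.

Lemma derived_lcode l z : derived (lcode l) z = valid l && (z \in l).
Proof.
rewrite /derived memn_lcode; congr (_ && _).
have -> : valid l = all (fun i => if drop i l is z' :: l' then just (lcode l') z'
                                  else true) (iota 0 (size l)).
  elim: l => //= z' l ->; congr (_ && _).
  by rewrite -[1]addn0 iotaDl all_map.
apply/ballP/allP => [h i|h i _].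
  rewrite mem_iota => lt_i; have := h i (leq_trans lt_i (size_lcode l)).
  by rewrite suffix_lcode; case: (drop i l) => //= z' l'; rewrite !cpairK.
rewrite suffix_lcode; have := h i; rewrite mem_iota /= add0n.
case: (ltnP i (size l)) => [_ /(_ isT)|le_i _]; last by rewrite drop_oversize.
by case: (drop i l) => //= z' l'; rewrite !cpairK.
Qed.

Lemma orb_mono (a b a' b' : bool) : (a -> a') -> (b -> b') -> a || b -> a' || b'.
Proof. by case: a b a' b' => [] [] [] [] // => [/(_ isT)|/(_ isT)|_ /(_ isT)]. Qed.

Lemma andb_mono (a b a' b' : bool) : (a -> a') -> (b -> b') -> a && b -> a' && b'.
Proof. by move=> ha hb /andP[/ha-> /hb->]. Qed.

(** Membership occurs only positively in the rules, and a bounded witness stays below [w'] because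
    it is part of a judgement that [w'] contains. *)
Lemma just_mono w w' z : (forall v, memn w v -> memn w' v) ->
  just w z -> just w' z.
Proof.
move=> h; rewrite /just; case: ifP => _.
  by rewrite /just_code; do ![apply: orb_mono|apply: andb_mono]; try exact: h.
apply: andb_mono => //; rewrite /just_eval.
do ![apply: orb_mono|apply: andb_mono] => //; try exact: h.
- case/bexP=> v [_ /andP[/h m1 /h m2]]; apply/bexP; exists v; rewrite m1 m2; split=> //.
  exact: leq_ltn_trans (jeval_ge _ _ _) (memn_lt m1).
- case/bexP=> v [_ /andP[/h m1 /h m2]]; apply/bexP; exists v; rewrite m1 m2; split=> //.
  exact: leq_ltn_trans (jeval_ge _ _ _) (memn_lt m1).
- move=> /ballP hy; apply/ballP => m /hy /bexP[v [_ /h m1]]; apply/bexP; exists v.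
  split=> //; exact: leq_trans (jeval_ge _ _ _) (ltnW (memn_lt m1)).
Qed.

Definition sound (z : nat) : Prop :=
  if cfst z == 0 then exists p, code p = csnd z
  else exists p, code p = cfst (csnd z) /\
    eval empty_oracle p (cfst (csnd (csnd z))) (csnd (csnd (csnd z))).

Lemma sound_jcode c : sound (jcode c) -> exists p, code p = c.
Proof. by rewrite /sound /jcode !cpairK. Qed.

Lemma sound_jeval c x y : sound (jeval c x y) ->
  exists p, code p = c /\ eval empty_oracle p x y.
Proof. by rewrite /sound /jeval !cpairK. Qed.

Lemma cpair_eq t a c : (cfst c == t) -> a = csnd c -> cpair t a = c.
Proof. by move=> /eqP <- ->; exact: cfst_csndK. Qed.

Lemma just_code_sound w c : (forall z, memn w z -> sound z) ->
  just_code w c -> exists p, code p = c.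
Proof.
move=> h; rewrite /just_code => /or3P[/andP[t5 /eqP a0]|/and4P[t6 t8 m1 m2]|/andP[t9 m]].
- rewrite -(cfst_csndK c) a0; move: (cfst c) t5 => [|[|[|[|[|[|//]]]]]] _.
  + by exists PZero.
  + by exists PSucc.
  + by exists PId.
  + by exists PFst.
  + by exists PSnd.
  + by exists POrac.
- have [p Ep] := sound_jcode (h _ m1); have [q Eq] := sound_jcode (h _ m2).
  have [E|[E|E]] : cfst c = 6 \/ cfst c = 7 \/ cfst c = 8 by lia.
  + by exists (PPair p q); rewrite /= Ep Eq cfst_csndK; apply: cpair_eq; rewrite ?E.
  + by exists (PComp p q); rewrite /= Ep Eq cfst_csndK; apply: cpair_eq; rewrite ?E.
  + by exists (PPrim p q); rewrite /= Ep Eq cfst_csndK; apply: cpair_eq; rewrite ?E.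
- have [p Ep] := sound_jcode (h _ m).
  by exists (PMu p); rewrite /= Ep; apply: cpair_eq.
Qed.

Lemma just_eval_sound w c x y : (forall z, memn w z -> sound z) ->
  just_eval w c x y -> exists p, code p = c /\ eval empty_oracle p x y.
Proof.
move=> h; rewrite /just_eval; do !case/orP.
- case/and3P=> t /eqP a /eqP ->; exists PZero; split; last by constructor.
  by apply: cpair_eq.
- case/and3P=> t /eqP a /eqP ->; exists PSucc; split; last by constructor.
  by apply: cpair_eq.
- case/and3P=> t /eqP a /eqP ->; exists PId; split; last by constructor.
  by apply: cpair_eq.
- case/and3P=> t /eqP a /eqP ->; exists PFst; split; last exact: evalFst.
  by apply: cpair_eq.
- case/and3P=> t /eqP a /eqP ->; exists PSnd; split; last exact: evalSnd.
  by apply: cpair_eq.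
- case/and3P=> t /eqP a /eqP ->; exists POrac; split; last by constructor.
  by apply: cpair_eq.
- case/and3P=> t /h/sound_jeval[p [Ep ep]] /h/sound_jeval[q [Eq eq]].
  exists (PPair p q); split; first by rewrite /= Ep Eq cfst_csndK; apply: cpair_eq.
  by rewrite -(cfst_csndK y); constructor.
- case/andP=> t /bexP[v [_ /andP[/h/sound_jeval[q [Eq eq]] /h/sound_jeval[p [Ep ep]]]]].
  exists (PComp p q); split; first by rewrite /= Ep Eq cfst_csndK; apply: cpair_eq.
  by econstructor; eassumption.
- case/and4P=> t /eqP x0 /h/sound_jeval[p [Ep ep]] /h/sound_jcode[q Eq].
  exists (PPrim p q); split; first by rewrite /= Ep Eq cfst_csndK; apply: cpair_eq.
  by rewrite -(cfst_csndK x) x0; constructor.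
- case/and3P=> t x0 /bexP[v [_ /andP[/h/sound_jeval[r [Er er]] /h/sound_jeval[q [Eq eq]]]]].
  (* The premise only yields some program [r] with code [c]. The tag 8 forces [r] to be a primitive
     recursion, and injectivity of [code] identifies its step program with [q]. *)
  have [p Ep] : exists p, r = PPrim p q.
    case: r Er er => [||||||p p'|p p'|p p'|p] /= Er; move: t;
      rewrite -Er cpairK //= => _ er.
    exists p; congr PPrim; apply: code_inj.
    by rewrite Eq -Er !cpairK.
  exists r; split=> //; rewrite -(cfst_csndK x) -(prednK x0) Ep.
  by apply: ePrimS eq; rewrite -Ep.
- case/and3P=> t /h/sound_jeval[p [Ep ep]] /ballP hm.
  exists (PMu p); split; first by rewrite /= Ep; apply: cpair_eq.
  constructor=> // m /hm /bexP[k [_ /h/sound_jeval[q [Eq eq]]]].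
  by exists k; rewrite (code_inj (etrans Ep (esym Eq))).
Qed.

(** Induction from the end of the list: the premises of an entry come later in it and are already
    known to be sound. *)
Lemma valid_sound l : valid l -> forall z, z \in l -> sound z.
Proof.
elim: l => //= z l IHl /andP[jz /IHl{}IHl] z'; rewrite inE => /predU1P[->|/IHl//].
have {}IHl v : memn (lcode l) v -> sound v by rewrite memn_lcode => /IHl.
move: jz; rewrite /just /sound; case: ifP => _; first exact: just_code_sound.
by case/andP=> _; exact: just_eval_sound.
Qed.

Definition derivable z := exists l, valid l /\ z \in l.

(** The entries of [l] keep their premises when [l'] is appended, by [just_mono]. *)
Lemma valid_cat l l' : valid l -> valid l' -> valid (l ++ l').
Proof.
elim: l => //= z l IHl /andP[jz /IHl{}IHl] /IHl ->; rewrite andbT.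
by apply: just_mono jz => v; rewrite !memn_lcode mem_cat => ->.
Qed.

Lemma derivable_all (s : seq nat) : (forall z, z \in s -> derivable z) ->
  exists l, valid l /\ forall z, z \in s -> memn (lcode l) z.
Proof.
elim: s => [|z s IHs] h; first by exists [::].
case: IHs => [v vs|l [vl hl]]; first by apply: h; rewrite inE vs orbT.
have [l' [vl' hl']] : derivable z by apply: h; rewrite mem_head.
exists (l' ++ l); split; first exact: valid_cat.
move=> v; rewrite memn_lcode mem_cat inE => /predU1P[->|/hl]; first by rewrite hl'.
by rewrite memn_lcode orbC => ->.
Qed.

(** The certificates of the premises [s] are merged into one, and [z] is put in front. Completeness
    applies this once for each rule. *)
Lemma derivable_rule (s : seq nat) z : (forall v, v \in s -> derivable v) ->
  (forall w, (forall v, v \in s -> memn w v) -> just w z) -> derivable z.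
Proof.
move=> /derivable_all[l [vl hl]] hj; exists (z :: l).
by rewrite /= vl mem_head hj.
Qed.

Lemma just_jcode w c : just w (jcode c) = just_code w c.
Proof. by rewrite /just /jcode !cpairK. Qed.

Lemma just_jeval w c x y : just w (jeval c x y) = just_eval w c x y.
Proof. by rewrite /just /jeval !cpairK. Qed.

Lemma derivable_code p : derivable (jcode (code p)).
Proof.
have leaf t : t <= 5 -> derivable (jcode (cpair t 0)).
  move=> t5; apply: (@derivable_rule [::]) => // w _.
  by rewrite just_jcode /just_code !cpairK t5.
have node t f g : 6 <= t <= 8 -> derivable (jcode f) -> derivable (jcode g) ->
    derivable (jcode (cpair t (cpair f g))).
  move=> /andP[t6 t8] df dg; apply: (@derivable_rule [:: jcode f; jcode g]).
    by move=> v; rewrite !inE => /orP[]/eqP ->.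
  move=> w hw; rewrite just_jcode /just_code !cpairK t6 t8.
  have -> : memn w (jcode f) by apply: hw; rewrite !inE eqxx.
  have -> : memn w (jcode g) by apply: hw; rewrite !inE eqxx orbT.
  by rewrite orbT.
elim: p => [||||||f IHf g IHg|f IHf g IHg|f IHf g IHg|f IHf] /=;
  try exact: leaf; try exact: node.
apply: (@derivable_rule [:: jcode (code f)]).
  by move=> v; rewrite !inE => /eqP ->.
move=> w hw; rewrite just_jcode /just_code !cpairK /= hw ?orbT //.
by rewrite mem_head.
Qed.

Lemma derivable_eval p x y :
  eval empty_oracle p x y -> derivable (jeval (code p) x y).
Proof.
have leaf t a b : (forall w, just_eval w (cpair t 0) a b) ->
    derivable (jeval (cpair t 0) a b).
  by move=> h; apply: (@derivable_rule [::]) => // w _; rewrite just_jeval.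
elim: p x y => [||||||f IHf g IHg|f IHf g IHg|f IHf g IHg|f IHf] x y.
- by inversion 1; subst; apply: leaf => w; rewrite /just_eval !cpairK.
- by inversion 1; subst; apply: leaf => w; rewrite /just_eval !cpairK !eqxx.
- by inversion 1; subst; apply: leaf => w; rewrite /just_eval !cpairK !eqxx.
- by move/evalFstE => ->; apply: leaf => w; rewrite /just_eval !cpairK !eqxx.
- by move/evalSndE => ->; apply: leaf => w; rewrite /just_eval !cpairK !eqxx.
- inversion 1; subst; first by [].
  by apply: leaf => w; rewrite /just_eval !cpairK !eqxx.
- move=> /evalPairE[a [b [/IHf ea /IHg eb ->]]].
  apply: (@derivable_rule [:: jeval (code f) x a; jeval (code g) x b]).
    by move=> v; rewrite !inE => /orP[]/eqP ->.
  move=> w hw; rewrite just_jeval /just_eval /= !cpairK /=.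
  have -> : memn w (jeval (code f) x a) by apply: hw; rewrite !inE eqxx.
  have -> : memn w (jeval (code g) x b) by apply: hw; rewrite !inE eqxx orbT.
  by rewrite ?orbT.
- move=> /evalCompE[a [/IHg ea /IHf eb]].
  apply: (@derivable_rule [:: jeval (code g) x a; jeval (code f) a y]).
    by move=> v; rewrite !inE => /orP[]/eqP ->.
  move=> w hw; rewrite just_jeval /just_eval /= !cpairK /=.
  set B := bex _ _; suff -> : B by rewrite ?orbT.
  have m1 : memn w (jeval (code g) x a) by apply: hw; rewrite !inE eqxx.
  have m2 : memn w (jeval (code f) a y) by apply: hw; rewrite !inE eqxx orbT.
  apply/bexP; exists a; rewrite m1 m2; split=> //.
  exact: leq_ltn_trans (jeval_ge _ _ _) (memn_lt m1).
- rewrite -(cfst_csndK x); move: (cfst x) (csnd x) => {}x n.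
  elim: n y => [|n IHn] y.
    move=> /evalPrim0E/IHf ea.
    apply: (@derivable_rule [:: jeval (code f) x y; jcode (code g)]).
      by move=> v; rewrite !inE => /orP[]/eqP -> //; exact: derivable_code.
    move=> w hw; rewrite just_jeval /just_eval /= !cpairK /=.
    have -> : memn w (jeval (code f) x y) by apply: hw; rewrite !inE eqxx.
    have -> : memn w (jcode (code g)) by apply: hw; rewrite !inE eqxx orbT.
    by rewrite ?orbT.
  move=> /evalPrimSE[a [/IHn ea /IHg eb]].
  apply: (@derivable_rule [:: jeval (code (PPrim f g)) (cpair x n) a;
                             jeval (code g) (cpair x (cpair n a)) y]).
    by move=> v; rewrite !inE => /orP[]/eqP ->.
  move=> w hw; rewrite just_jeval /just_eval /= !cpairK /=.
  set B := bex _ _; suff -> : B by rewrite ?orbT.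
  have m1 : memn w (jeval (code (PPrim f g)) (cpair x n) a).
    by apply: hw; rewrite !inE eqxx.
  have m2 : memn w (jeval (code g) (cpair x (cpair n a)) y).
    by apply: hw; rewrite !inE eqxx orbT.
  apply/bexP; exists a; rewrite m1 m2; split=> //.
  exact: leq_ltn_trans (jeval_ge _ _ _) (memn_lt m1).
- move=> /evalMuE[/IHf e0 lt].
  (* The rule for [PMu] has one premise for each [m < y], so their values are chosen together to
     form the finite list [s]; from [y] on the choice is vacuous. *)
  have /choice[k hk] m : exists k, m < y -> derivable (jeval (code f) (cpair x m) k.+1).
    case: (boolP (m < y)) => [/lt[k /IHf ek]|_]; first by exists k.
    by exists 0.
  pose s := [seq jeval (code f) (cpair x m) (k m).+1 | m <- iota 0 y].
  apply: (@derivable_rule (jeval (code f) (cpair x y) 0 :: s)).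
    move=> v; rewrite inE => /predU1P[->//|/mapP[m]].
    by rewrite mem_iota => /hk hm ->.
  move=> w hw; rewrite just_jeval /just_eval /= !cpairK /=.
  rewrite hw ?mem_head //=; set B := ball _ _; suff -> : B by rewrite ?orbT.
  apply/ballP => m lt_m; apply/bexP; exists (k m).
  have m1 : memn w (jeval (code f) (cpair x m) (k m).+1).
    apply: hw; rewrite inE.
    rewrite (map_f (fun m => jeval (code f) (cpair x m) (k m).+1)) ?orbT //.
    by rewrite mem_iota.
  split=> //; exact: leq_trans (jeval_ge _ _ _) (ltnW (memn_lt m1)).
Qed.

(** The stage [s] bounds the certificate [w]; the output [y] occurs in a judgement of [w] and is
    thereby below [w]. *)
Definition halts_within (e s : nat) : bool :=
  bex (fun w => bex (fun y => derived w (jeval e e y)) w) s.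

Lemma comp_halts_within A f g : computable_in A f -> computable_in A g ->
  computable_in A (fun x => halts_within (f x) (g x)).
Proof.
move=> cf cg; apply: (@comp_app2 _ halts_within) => //.
rewrite /halts_within /derived /jeval.
by repeat (computability; first [apply: comp_memn|apply: comp_just|apply: comp_suffix]).
Qed.

Lemma halts_within_mono e s s' : s <= s' -> halts_within e s -> halts_within e s'.
Proof.
move=> le_s /bexP[w [lt h]]; apply/bexP; exists w; split=> //.
exact: leq_trans le_s.
Qed.

(** Completeness of certificates ([derivable_eval]) gives one direction, their soundness
    ([valid_sound]) the other. *)
Lemma halting_setP e : halting_set e <-> exists s, halts_within e s.
Proof.
split=> [[p [<- [y /derivable_eval[l [vl hl]]]]]|[s /bexP[w [_ /bexP[y [_]]]]]].
  exists (lcode l).+1; apply/bexP; exists (lcode l); split=> //.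
  apply/bexP; exists y; rewrite derived_lcode vl; split=> //.
  apply: leq_ltn_trans (jeval_ge (code p) (code p) y) _.
  by rewrite memn_lt // memn_lcode.
have [l ->] := lcode_surj w; rewrite derived_lcode => /andP[vl hl].
have [p [Ep ep]] := sound_jeval (valid_sound vl hl).
by exists p; split=> //; exists y.
Qed.

End Certificates.

(** * The limit lemma *)

Section LimitLemma.
Local Open Scope nat_scope.
Variables (A : nat -> Prop) (H : nat -> nat -> bool).
Hypothesis H_lim : forall x, exists s0, forall s, s0 <= s -> A x <-> H x s.
Hypothesis comp_H : forall f g, computable f -> computable g ->
  computable (fun x => H (f x) (g x)).

(** Total at every stage: oracle questions are answered by stage [s] of [H], and unbounded search is
    cut off at [s], where it returns the meaningless value [s]. *)
Fixpoint approx (p : prog) (x s : nat) : nat :=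
  match p with
  | PZero => 0 | PSucc => x.+1 | PId => x | PFst => cfst x | PSnd => csnd x
  | POrac => H x s
  | PPair f g => cpair (approx f x s) (approx g x s)
  | PComp f g => approx f (approx g x s) s
  | PPrim f g => natrec (approx f (cfst x) s)
      (fun n a => approx g (cpair (cfst x) (cpair n a)) s) (csnd x)
  | PMu f => bmu (fun m => approx f (cpair x m) s == 0) s
  end.

Lemma comp_approx p f g : computable f -> computable g ->
  computable (fun x => approx p (f x) (g x)).
Proof.
rewrite /computable.
elim: p f g => [||||||p IHp q IHq|p IHp q IHq|p IHp q IHq|p IHp] f g cf cg /=;
  try by computability.
- exact: comp_H.
- by apply: comp_pair; [exact: IHp|exact: IHq].
- by apply: IHp => //; exact: IHq.
- by apply: (@comp_rec _ _ (fun x n a => approx q (cpair (cfst (f x)) (cpair n a)) (g x)));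
    [apply: IHp|apply: IHq|]; computability.
- apply: (@comp_bmu _ (fun x m => approx p (cpair (f x) m) (g x) == 0)) => //.
  by computability; apply: IHp; computability.
Qed.

(** A halting computation rests on finitely many oracle answers and subcomputations; from the
    maximum of their settling stages on, the approximation is constant. *)
Lemma approx_lim p x y : eval A p x y ->
  exists s0, forall s, s0 <= s -> approx p x s = y.
Proof.
elim: p x y => [||||||f IHf g IHg|f IHf g IHg|f IHf g IHg|f IHf] x y /=.
- by inversion 1; exists 0.
- by inversion 1; exists 0.
- by inversion 1; exists 0.
- by move/evalFstE => ->; exists 0.
- by move/evalSndE => ->; exists 0.
- move=> e; have [s0 h] := H_lim x; exists s0 => s /h {}h.
  case: (H x s) h => -[h1 h2]; inversion e => //; subst; exfalso; first by have := h2 isT.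
  by have := h1 ltac:(assumption).
- move=> /evalPairE[a [b [/IHf[s hs] /IHg[t ht] ->]]].
  by exists (maxn s t) => u; rewrite geq_max => /andP[/hs-> /ht->].
- move=> /evalCompE[a [/IHg[s hs] /IHf[t ht]]].
  by exists (maxn s t) => u; rewrite geq_max => /andP[/hs-> /ht->].
- rewrite -(cfst_csndK x); move: (cfst x) (csnd x) => {}x n.
  rewrite !cpairK; elim: n y => [|n IHn] y /=; first by move=> /evalPrim0E/IHf.
  move=> /evalPrimSE[a [/IHn[s hs] /IHg[t ht]]].
  by exists (maxn s t) => u; rewrite geq_max => /andP[/hs-> /ht->].
- move=> /evalMuE[/IHf[s hs] lt].
  have [t ht] : exists t, forall u m, t <= u -> m < y -> approx f (cpair x m) u != 0.
    elim: y {hs} lt => [|y IHy] lt; first by exists 0.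
    have [t ht] := IHy (fun m h => lt m (ltnW h)).
    have [k /IHf[t' ht']] := lt y (ltnSn y).
    exists (maxn t t') => u m; rewrite geq_max => /andP[tu t'u].
    by rewrite ltnS leq_eqVlt => /predU1P[->|/ht-> //]; rewrite ht'.
  (* The stage must exceed [y] for the bounded search to reach it; [s] settles the zero at [y], and
     [t] the nonzero values at all [m < y]. *)
  exists (maxn y.+1 (maxn s t)) => u; rewrite !geq_max => /and3P[lt_u /hs hy /ht {}ht].
  have Eu : iota 0 u = iota 0 y ++ y :: iota y.+1 (u - y).-1.
    by rewrite {1}(_ : u = y + (u - y).-1.+1) ?iotaD //; lia.
  rewrite /bmu Eu find_cat /= hy // eqxx addn0 size_iota.
  rewrite (_ : has _ _ = false) //; apply/hasP => -[m].
  by rewrite mem_iota => /ht/negPf ->.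
Qed.

End LimitLemma.

Lemma limit_lemma f : computable_in halting_set f ->
  exists g : nat -> nat -> nat, computable (fun z => g (cfst z) (csnd z)) /\
    forall x, exists s0, forall s, (s0 <= s)%N -> g x s = f x.
Proof.
move=> [p hp]; exists (approx halts_within p); split.
  by apply: comp_approx; [exact: comp_halts_within|rewrite /computable; computability..].
move=> x; apply: (@approx_lim halting_set) => // {}x.
(* The finite stages increase, so they settle at the first positive answer, or are constantly false
   from stage 0 on. *)
have [/halting_setP[s hs]|nh] := pselect (halting_set x).
  exists s => t st; split=> _; last by apply/halting_setP; exists s.
  exact: halts_within_mono hs.
by exists 0%N => t _; split=> // h; case: nh; apply/halting_setP; exists t.
Qed.

(* The program [PComp (PMu p) c_x], with [c_x] a constant program for [x], runs
   on any input, in particular its own code, exactly as [PMu p] on [x]. *)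
Lemma smn (g : nat -> nat -> nat) : computable (fun z => g (cfst z) (csnd z)) ->
  exists e, computable e /\
    forall x, halting_set (e x) <-> exists n, g x n = 0%N.
Proof.
move=> [p hp].
pose fix cst x := if x is x'.+1 then PComp PSucc (cst x') else PZero.
have eval_cst x y : eval empty_oracle (cst x) y x.
  elim: x => [|x IHx]; first by constructor.
  by apply: eComp IHx _; constructor.
have hp' x n : eval empty_oracle p (cpair x n) (g x n).
  by have := hp (cpair x n); rewrite !cpairK.
exists (fun x => cpair 7 (cpair (code (PMu p))
   (natrec (cpair 0 0) (fun _ a => cpair 7 (cpair (cpair 1 0) a)) x))).
split; first by rewrite /computable; computability.
move=> x.
have -> : natrec (cpair 0 0) (fun _ a => cpair 7 (cpair (cpair 1 0) a)) x = code (cst x).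
  by elim: x => //= x ->.
rewrite -[cpair 7 _]/(code (PComp (PMu p) (cst x))); split=> [[q [/code_inj -> [y]]]|[n gn]].
  move=> /evalCompE[z [/(eval_det (eval_cst _ _)) <- /evalMuE[e0 _]]].
  by exists y; apply: eval_det e0.
exists (PComp (PMu p) (cst x)); split=> //.
have ex : exists n, g x n == 0%N by exists n; rewrite gn.
case: (ex_minnP ex) => m /eqP gm mmin; exists m.
apply: eComp (eval_cst _ _) _; constructor; first by rewrite -gm.
move=> k lt; exists (g x k).-1; rewrite prednK // lt0n.
by apply/negP => /mmin; rewrite leqNgt lt.
Qed.

(** * Rational codes *)

Section RationalCodes.

Definition rdec (z : nat) : rat :=
  rat_of_nats (cfst z) (cfst (csnd z)) (csnd (csnd z)).

(** Packs the three functions into one, so that later constructions handle a single number per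
    rational. *)
Lemma ratseq_computableP A q : ratseq_computable_in A q <->
  exists f, computable_in A f /\ forall n, q n = rdec (f n).
Proof.
split=> [[a [b [c [ca cb cc qE]]]]|[f [cf qE]]].
  exists (fun n => cpair (a n) (cpair (b n) (c n))); split; first by computability.
  by move=> n; rewrite qE /rdec !cpairK.
exists (fun n => cfst (f n)), (fun n => cfst (csnd (f n))), (fun n => csnd (csnd (f n))).
by split=> //; computability.
Qed.

(** Cross-multiplied, with the negative parts moved to the other side so that truncated subtraction
    is avoided. *)
Definition rle (z w : nat) : bool :=
  (cfst z * (csnd (csnd w)).+1 + cfst (csnd w) * (csnd (csnd z)).+1 <=
   cfst w * (csnd (csnd z)).+1 + cfst (csnd z) * (csnd (csnd w)).+1)%N.

Lemma rleE z w : rle z w = (rdec z <= rdec w).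
Proof.
rewrite /rle /rdec /rat_of_nats.
move: (cfst z) (cfst (csnd z)) (csnd (csnd z)) (cfst w) (cfst (csnd w)) (csnd (csnd w)).
move=> a b c a' b' c'.
rewrite ler_pdivrMr ?ltr0Sn // mulrAC ler_pdivlMr ?ltr0Sn // !mulrBl.
by rewrite lerBlDr addrAC lerBrDr -!natrM -!natrD ler_nat.
Qed.

Lemma comp_rle A f g : computable_in A f -> computable_in A g ->
  computable_in A (fun x => rle (f x) (g x)).
Proof. by move=> cf cg; rewrite /rle; computability. Qed.

(** Codes store the denominator minus one, whence the successors and the final predecessor. *)
Definition radd (z w : nat) : nat :=
  let c := (csnd (csnd z)).+1 in let c' := (csnd (csnd w)).+1 in
  cpair (cfst z * c' + cfst w * c)%N
    (cpair (cfst (csnd z) * c' + cfst (csnd w) * c)%N (c * c').-1).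

Lemma rdecD z w : rdec (radd z w) = rdec z + rdec w.
Proof.
rewrite /rdec /radd /rat_of_nats !cpairK prednK ?muln_gt0 // !natrD !natrM.
by field; rewrite !nat1r !pnatr_eq0.
Qed.

Lemma comp_radd A f g : computable_in A f -> computable_in A g ->
  computable_in A (fun x => radd (f x) (g x)).
Proof. by move=> cf cg; rewrite /radd; computability. Qed.

Definition rdivn (z k : nat) : nat :=
  cpair (cfst z) (cpair (cfst (csnd z)) ((csnd (csnd z)).+1 * k).-1).

Lemma rdec_divn z k : (0 < k)%N -> rdec (rdivn z k) = rdec z / k%:R.
Proof.
move=> k0; rewrite /rdec /rdivn /rat_of_nats !cpairK prednK ?muln_gt0 //.
by rewrite natrM invfM mulrA.
Qed.

Lemma comp_rdivn A f g : computable_in A f -> computable_in A g ->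
  computable_in A (fun x => rdivn (f x) (g x)).
Proof. by move=> cf cg; rewrite /rdivn; computability. Qed.

Definition rsum (F : nat -> nat) (n : nat) : nat :=
  natrec 0 (fun i a => radd a (F i)) n.

Lemma rdec0 : rdec 0 = 0.
Proof. by rewrite /rdec /rat_of_nats subrr mul0r. Qed.

Lemma rdec_sum F n : rdec (rsum F n) = \sum_(i < n) rdec (F i).
Proof.
rewrite /rsum; elim: n => [|n IHn] /=; first by rewrite big_ord0 rdec0.
by rewrite rdecD IHn big_ord_recr.
Qed.

Lemma comp_rsum A (F : nat -> nat -> nat) n :
  computable_in A (fun z => F (cfst z) (csnd z)) -> computable_in A n ->
  computable_in A (fun x => rsum (F x) (n x)).
Proof.
move=> cF cn; apply: (@comp_rec _ _ (fun x i a => radd a (F x i))) => //.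
  exact: comp_const.
apply: comp_radd; first by computability.
by apply: (@comp_app2 _ F) => //; computability.
Qed.

(* The minimum is started at 1, which is harmless because [alpha <= 1]. *)
Definition rmins (F : nat -> nat) (n : nat) : nat :=
  natrec (cpair 1 (cpair 0 0)) (fun i a => if rle a (F i) then a else F i) n.

Lemma rdec_mins0 F : rdec (rmins F 0) = 1.
Proof. by rewrite /rmins /= /rdec /rat_of_nats !cpairK subr0 invr1 mulr1. Qed.

Lemma rdec_minsS F n : rdec (rmins F n.+1) = Num.min (rdec (rmins F n)) (rdec (F n)).
Proof. by rewrite /rmins /= -/(rmins F n) rleE; case: leP. Qed.

Lemma comp_rmins A (F : nat -> nat -> nat) n :
  computable_in A (fun z => F (cfst z) (csnd z)) -> computable_in A n ->
  computable_in A (fun x => rmins (F x) (n x)).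
Proof.
move=> cF cn.
apply: (@comp_rec _ _ (fun x i a => if rle a (F x i) then a else F x i)) => //.
  exact: comp_const.
have cF' : computable_in A (fun z => F (cfst z) (cfst (csnd z))).
  by apply: (@comp_app2 _ F) => //; computability.
by apply: comp_ite => //; [apply: comp_rle => //|]; computability.
Qed.

Lemma rdec_mins_le F n i : (i < n)%N -> rdec (rmins F n) <= rdec (F i).
Proof.
elim: n => // n IHn; rewrite ltnS leq_eqVlt rdec_minsS => /predU1P[->|/IHn le_i].
  by rewrite ge_min lexx orbT.
by rewrite ge_min le_i.
Qed.

(** Serves to bound the minimum from below: a common lower bound of 1 and of the entries carries
    over. *)
Lemma rdec_mins_attained F n :
  rdec (rmins F n) = 1 \/ exists2 i, (i < n)%N & rdec (rmins F n) = rdec (F i).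
Proof.
elim: n => [|n IHn]; first by left; exact: rdec_mins0.
rewrite rdec_minsS; case: (leP (rdec (rmins F n))) => _; last by right; exists n.
by case: IHn => [|[i lt_i ->]]; [left|right; exists i; rewrite // ltnW].
Qed.

End RationalCodes.

(** * Limits of real sequences *)

Section Limits.
Variable R : realType.
Implicit Types (u : nat -> R) (l : R).

Lemma nondecreasing_cvg_sup u l : (forall n, u n <= u n.+1) ->
  (forall n, u n <= l) -> (forall e, 0 < e -> exists n, l - e < u n) ->
  u n @[n --> \oo] --> l.
Proof.
move=> /nondecreasing_seqP ndu ul el; apply/cvgrPdist_lt => e /el[n0 lt0].
exists n0 => // n /= le_n; rewrite ger0_norm ?subr_ge0 //.
by rewrite ltrBlDr -ltrBlDl (lt_le_trans lt0) // ndu.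
Qed.

Lemma nonincreasing_cvg_inf u l : (forall n, u n.+1 <= u n) ->
  (forall n, l <= u n) -> (forall e, 0 < e -> exists n, u n < l + e) ->
  u n @[n --> \oo] --> l.
Proof.
move=> /nonincreasing_seqP niu ul el; apply/cvgrPdist_lt => e /el[n0 lt0].
exists n0 => // n /= le_n; rewrite ler0_norm ?subr_le0 // opprB.
by rewrite ltrBlDl (le_lt_trans _ lt0) // niu.
Qed.

Lemma nondecreasing_cvg_le u l : (forall n, u n <= u n.+1) ->
  u n @[n --> \oo] --> l -> forall n, u n <= l.
Proof.
move=> /nondecreasing_seqP ndu ul n.
have := nondecreasing_cvgn_le ndu (cvgP _ ul) n.
by rewrite (cvg_lim _ ul).
Qed.

Lemma nonincreasing_cvg_ge u l : (forall n, u n.+1 <= u n) ->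
  u n @[n --> \oo] --> l -> forall n, l <= u n.
Proof.
move=> /nonincreasing_seqP ndu ul n.
have := nonincreasing_cvgn_ge ndu (cvgP _ ul) n.
by rewrite (cvg_lim _ ul).
Qed.

Lemma cvg_near_gt u l x : u n @[n --> \oo] --> l -> x < l -> exists n, x < u n.
Proof. by move=> /cvgr_gt h /h[n _ hn]; exists n; apply: (hn n) => /=. Qed.

Lemma cvg_near_lt u l x : u n @[n --> \oo] --> l -> l < x -> exists n, u n < x.
Proof. by move=> /cvgr_lt h /h[n _ hn]; exists n; apply: (hn n) => /=. Qed.

(** The identity min(x, y) = (x + y - |x - y|) / 2 reduces this to the limits of sums, differences
    and absolute values. *)
Lemma cvg_min u v l l' : u n @[n --> \oo] --> l -> v n @[n --> \oo] --> l' ->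
  Num.min (u n) (v n) @[n --> \oo] --> Num.min l l'.
Proof.
move=> ul vl; have minE (x y : R) : Num.min x y = (x + y - `|x - y|) / 2.
  case: (leP x y) => [xy|/ltW xy]; first by rewrite ler0_norm ?subr_le0 //; lra.
  by rewrite ger0_norm ?subr_ge0 //; lra.
rewrite minE (_ : (fun n => _) = (fun n => (u n + v n - `|u n - v n|) / 2)).
  apply: cvgMr_tmp; apply: cvgB; first exact: cvgD.
  by apply: cvg_norm; exact: cvgB.
by apply/funext => n; rewrite minE.
Qed.

Lemma inf_eq (S : set R) l : lbound S l -> (forall e, 0 < e -> exists2 x, S x & x < l + e) ->
  inf S = l.
Proof.
move=> lbl el; apply/le_anti/andP; split; last first.
  by apply: lb_le_inf => //; have [x Sx _] := el 1 ltr01; exists x.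
apply/ler_addgt0Pr => e /el[x Sx /ltW xe]; apply: le_trans xe.
by apply: ge_inf => //; exists l.
Qed.

Lemma ratr_le (x y : rat) : (ratr x <= ratr y :> R) = (x <= y).
Proof. exact: ler_rat. Qed.

Lemma ratr_min (x y : rat) : ratr (Num.min x y) = Num.min (ratr x) (ratr y) :> R.
Proof. by rewrite /Num.min /Order.min ltr_rat; case: ifP. Qed.

End Limits.

(** * The four implications *)

Section TrueStages.
Local Open Scope nat_scope.
Variables (g : nat -> nat -> nat) (f : nat -> nat).
Hypothesis g_lim : forall i, exists s0, forall s, s0 <= s -> g i s = f i.

(** The default is [s], for stages at which no index below [s] changes. *)
Definition first_change (s : nat) := bmu (fun i => g i s != g i s.+1) s.

Lemma first_change_large n : exists s0, forall s, s0 <= s ->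
  n < first_change s /\ forall i, i <= n -> g i s = f i.
Proof.
have [s0 h] : exists s0, forall s, s0 <= s -> forall i, i <= n -> g i s = f i.
  elim: n => [|n [s0 h0]].
    by have [s0 h0] := g_lim 0; exists s0 => s /h0 hs i; rewrite leqn0 => /eqP ->.
  have [s1 h1] := g_lim n.+1; exists (maxn s0 s1) => s; rewrite geq_max.
  move=> /andP[/h0 hs /h1 hs1] i; rewrite leq_eqVlt => /predU1P[->//|].
  exact: hs.
(* From [s0] on, the values up to [n] have settled; [s > n] lets the search, which is bounded by
   [s], get past [n]. *)
exists (maxn s0 n.+1) => s; rewrite geq_max => /andP[le_s lt_n].
split=> [|i]; last exact: h.
by apply: bmu_gt => // i le_i; rewrite negbK !h // ltnW.
Qed.

(* A stage [s >= s0] minimising [first_change] is a true stage: no index below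
   [first_change s] can change after [s]. *)
Lemma true_stage s0 : exists2 s, s0 <= s &
  forall i, i < first_change s -> g i s = f i.
Proof.
have ex : exists v, `[< exists2 s, s0 <= s & first_change s = v >].
  by exists (first_change s0); apply/asboolP; exists s0.
case: (ex_minnP ex) => v /asboolP[s le_s <-] vmin; exists s => // i lt_i.
have [s1 hs1] := g_lim i.
have const t : g i (s + t) = g i s.
  elim: t => [|t <-]; first by rewrite addn0.
  have le_v : first_change s <= first_change (s + t).
    by apply: vmin; apply/asboolP; exists (s + t) => //; exact: leq_trans (leq_addr _ _).
  have := bmuN (leq_trans lt_i le_v).
  by rewrite negbK addnS => /eqP.
by rewrite -(const s1) hs1 // leq_addl.
Qed.

End TrueStages.

Lemma limn_esup_inf (R : realType) (u : (\bar R)^nat) :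
  limn_esup u = ereal_inf (range (esups u)).
Proof. by rewrite limn_esup_lim; apply: cvg_lim => //; exact: cvg_esups_inf. Qed.

Section Implications.
Variable R : realType.
Variable alpha : R.
Hypothesis alpha01 : 0 <= alpha <= 1.

Lemma jump_right_ce_limsup : jump_right_ce alpha ->
  exists q : nat -> rat, ratseq_computable q /\
    alpha%:E = limn_esup (fun n => (ratr (q n) : R)%:E).
Proof.
move=> [q [/ratseq_computableP[f [/limit_lemma[g [cg g_lim]] qE]] [q_mono q_cvg]]].
have q_ge n : alpha <= ratr (q n).
  by apply: nonincreasing_cvg_ge q_cvg n => n; rewrite ratr_le.
pose r s := rdec (rmins (fun i => g i s) (first_change g s)).
exists r; split.
  apply/ratseq_computableP; exists (fun s => rmins (fun i => g i s) (first_change g s)).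
  have cg' a b : computable a -> computable b -> computable (fun x => g (a x) (b x)).
    exact: comp_app2.
  split=> //; apply: (@comp_rmins _ (fun s i => g i s)).
    by apply: cg'; rewrite /computable; computability.
  apply: (@comp_bmu _ (fun s i => g i s != g i s.+1)); last exact: comp_id.
  by apply/comp_negb/comp_eqn; apply: cg'; rewrite /computable; computability.
rewrite limn_esup_inf.
apply/le_anti/andP; split.
  apply/ereal_infP => _ [n _ <-].
  have [s le_s gs] := true_stage g_lim n.
  apply: (@le_trans _ _ (ratr (r s))%:E); last first.
    by apply: ereal_sup_ubound; exists s.
  (* The minimum is either the initial 1, which is at least [alpha], or some [g i s], which at this
     true stage is the final code of [q i]. *)
  rewrite lee_fin /r; case: (rdec_mins_attained (fun i => g i s) (first_change g s)).
    by move=> ->; rewrite rmorph1; case/andP: alpha01.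
  by move=> [i lt_i ->]; rewrite gs // -qE.
apply/lee_addgt0Pr => e e0.
(* From some stage on, the minimum takes the settled code of a term [q n < alpha + e] into account,
   so a whole tail stays below [alpha + e]. *)
have [n lt_n] := cvg_near_lt q_cvg (ltr_pwDr e0 (lexx alpha)).
have [s0 hs0] := first_change_large g_lim n.
apply: (@le_trans _ _ (esups (fun n => (ratr (r n) : R)%:E) s0)).
  by apply: ereal_inf_lbound; exists s0.
apply/ereal_supP => _ [s /= le_s <-].
have [lt_k gs] := hs0 s le_s.
rewrite -EFinD lee_fin (le_trans _ (ltW lt_n)) // ratr_le qE -(gs n) //.
exact: (rdec_mins_le (fun i => g i s)).
Qed.

Lemma limsup_inf : 
  (exists q : nat -> rat, ratseq_computable q /\
    alpha%:E = limn_esup (fun n => (ratr (q n) : R)%:E)) ->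
  exists r : nat -> R, uniform_left_ce r /\
    alpha%:E = ereal_inf (range (fun n => (r n)%:E)).
Proof.
move=> [q [/ratseq_computableP[f [cf qE]]]].
set u := fun n => _; rewrite limn_esup_inf => alphaE.
(* Early tail suprema may be infinite; since the limsup is the finite [alpha], they are real from
   some [n0] on, and [r] starts there. *)
have [n0 fin0] : exists n0, (esups u n0 < +oo)%E.
  have /ereal_inf_lt[_ [n0 _ <-]] : (ereal_inf (range (esups u)) < +oo)%E.
    by rewrite -alphaE ltry.
  by exists n0.
have esE n : (n0 <= n)%N -> (fine (esups u n))%:E = esups u n.
  move=> le_n; rewrite fineK // fin_real //; apply/andP; split.
    apply: (@lt_le_trans _ _ (u n)); first by rewrite ltNyr.
    by apply: ereal_sup_ubound; exists n => /=.
  by apply: le_lt_trans fin0; exact: nonincreasing_esups.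
exists (fun n => fine (esups u (n + n0))); split; last first.
  rewrite alphaE; apply/le_anti/andP; split.
    apply/ereal_infP => _ [n _ <-]; rewrite esE ?leq_addl //.
    by apply: ereal_inf_lbound; exists (n + n0)%N.
  apply/ereal_infP => _ [n _ <-].
  apply: (@le_trans _ _ (esups u (n + n0))).
    by rewrite -esE ?leq_addl //; apply: ereal_inf_lbound; exists n.
  by apply: nonincreasing_esups; rewrite leq_addr.
(* [Q m t] codes the maximum of [q k] for [k] from [m + n0] to [m + n0 + t]; as [t] grows, it
   increases to the tail supremum. *)
pose Q m t := natrec (f (m + n0)%N) (fun i a =>
  if rle a (f (m + n0 + i).+1%N) then f (m + n0 + i).+1%N else a) t.
have QS m t : rdec (Q m t.+1) = Num.max (rdec (Q m t)) (q (m + n0 + t).+1%N).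
  by rewrite /Q /= -/(Q m t) rleE qE; case: leP.
exists (fun m t => rdec (Q m t)); split.
  exists (fun z => rdec (Q (cfst z) (csnd z))); split; last by move=> m t; rewrite !cpairK.
  apply/ratseq_computableP; exists (fun z => Q (cfst z) (csnd z)); split=> //.
  rewrite /Q; apply: (@comp_rec _ _ (fun z i a => if rle a (f (cfst z + n0 + i).+1%N)
     then f (cfst z + n0 + i).+1%N else a)); computability.
  by apply: comp_rle; computability.
move=> m; have Q_mono t : rdec (Q m t) <= rdec (Q m t.+1) by rewrite QS le_max lexx.
split=> //; apply: nondecreasing_cvg_sup => [t|t|e e0].
- by rewrite ratr_le.
- rewrite -lee_fin esE ?leq_addl //.
  have [k le_k ->] : exists2 k, (m + n0 <= k)%N & rdec (Q m t) = q k.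
    elim: t => [|t [k le_k IHt]]; first by exists (m + n0)%N; rewrite // qE.
    rewrite QS IHt; case: leP => _; last by exists k.
    by exists (m + n0 + t).+1%N; rewrite // -addnS leq_addr.
  by apply: ereal_sup_ubound; exists k.
- have Q_ge t : q (m + n0 + t)%N <= rdec (Q m t).
    case: t => [|t]; first by rewrite addn0 qE.
    by rewrite addnS QS le_max lexx orbT.
  have : ((fine (esups u (m + n0)%N) - e)%R%:E < esups u (m + n0)%N)%E.
    by rewrite -{2}esE ?leq_addl // lte_fin ltrBlDr ltrDl.
  move=> /ereal_sup_gt[_ [k /= le_k <-]]; rewrite lte_fin => lt_k.
  exists (k - (m + n0))%N; apply: lt_le_trans lt_k _.
  by rewrite ratr_le; have := Q_ge (k - (m + n0))%N; rewrite subnKC.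
Qed.

End Implications.

(** * Sums over binary strings and the coding of strings *)

Section Strings.

Lemma sum_tuple_cons (V : nmodType) n (P : pred (seq bool)) (F : seq bool -> V) :
  \sum_(t : n.+1.-tuple bool | P t) F t =
  \sum_b \sum_(t : n.-tuple bool | P (b :: t)) F (b :: t).
Proof.
rewrite pair_big_dep /= (reindex (fun p : bool * n.-tuple bool => [tuple of p.1 :: p.2])) //=.
exists (fun t : n.+1.-tuple bool => (thead t, [tuple of behead t])) => [[b t] _|t _] /=.
  by rewrite theadE; congr (_, _); apply: val_inj.
by apply: val_inj; rewrite [in RHS](tuple_eta t).
Qed.

Lemma sum_tuple_prefix (V : nmodType) (s : seq bool) n (c : V) : (size s <= n)%N ->
  \sum_(t : n.-tuple bool | prefix s t) c = c *+ (2 ^ (n - size s))%N.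
Proof.
elim: s n => [|b s IHs] n.
  rewrite subn0 (eq_bigl (fun t => t \in {: n.-tuple bool})) => [|t].
    by rewrite sumr_const card_tuple card_bool.
  by rewrite prefix0s.
case: n => // n le_s; rewrite (sum_tuple_cons _ (prefix (b :: s)) (fun=> c)) (bigD1 b) //=.
rewrite [X in _ + X]big1 ?addr0 => [|b' nb]; last first.
  by rewrite big_pred0 // => t; rewrite eq_sym (negbTE nb).
under eq_bigl do rewrite eqxx /=.
exact: IHs.
Qed.

(** The strings of length [n] have exactly the codes from [2 ^ n] to [2 ^ n.+1 - 1]. The induction
    generalises the initial accumulator; the first bit selects one half of the interval. *)
Lemma sum_str_code (V : nmodType) n (F : nat -> V) :
  \sum_(t : n.-tuple bool) F (str_code t) = \sum_(j < 2 ^ n) F (2 ^ n + j)%N.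
Proof.
suff h a : \sum_(t : n.-tuple bool) F (foldl (fun a (b : bool) => a.*2 + b)%N a t) =
    \sum_(j < 2 ^ n) F (a * 2 ^ n + j)%N.
  by rewrite /str_code h; apply: eq_bigr => j _; rewrite mul1n.
elim: n a => [|n IHn] a.
  rewrite -(big_mkord xpredT (fun j => F (a * 2 ^ 0 + j)%N)) expn0 big_nat1 muln1 addn0.
  rewrite (eq_bigr (fun=> F a)) => [|t _]; last by rewrite tuple0.
  by rewrite sumr_const card_tuple.
rewrite (sum_tuple_cons _ xpredT (fun t => F (foldl _ a t))) big_bool /= !IHn.
have -> : (2 ^ n.+1 = 2 ^ n + 2 ^ n)%N by rewrite expnS mul2n addnn.
rewrite big_split_ord /= addrC.
by congr (_ + _); apply: eq_bigr => j _; congr F; rewrite -?mul2n /=; lia.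
Qed.

Lemma str_code_bounds s : (2 ^ size s <= str_code s < 2 ^ (size s).+1)%N.
Proof.
elim/last_ind: s => // s b; rewrite /str_code foldl_rcons size_rcons !expnS.
by case: b; lia.
Qed.

(** The binary logarithm, which recovers the length of a string from its code by
    [str_code_bounds]. *)
Definition str_size (x : nat) : nat := bmu (fun k => x < 2 ^ k.+1)%N x.

Lemma str_sizeE s : str_size (str_code s) = size s.
Proof.
have /andP[lo hi] := str_code_bounds s; apply: bmuE => // [|i lt_i].
  exact: leq_trans (ltn_expl _ _) lo.
by rewrite -leqNgt; apply: leq_trans lo; rewrite leq_exp2l.
Qed.

Lemma comp_str_size A f : computable_in A f -> computable_in A (fun x => str_size (f x)).
Proof.
move=> cf; apply: (@comp_comp _ str_size) => //.
apply: (@comp_bmu _ (fun x k => x < 2 ^ k.+1)%N); last exact: comp_id.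
by apply: comp_leq; [|apply: comp_pow2]; computability.
Qed.

End Strings.

(** * From infima of left-c.e. reals to semi-measures, and back to the jump *)

Section SemimeasureImplications.
Variable R : realType.
Variable alpha : R.
Hypothesis alpha01 : 0 <= alpha <= 1.

Lemma inf_semimeasure :
  (exists r : nat -> R, uniform_left_ce r /\
     alpha%:E = ereal_inf (range (fun n => (r n)%:E))) ->
  exists rho : seq bool -> R, left_ce_semimeasure rho /\
    forall s : seq bool, rhobar rho s = alpha * 2 ^- size s.
Proof.
move=> [r [[q [[q' [/ratseq_computableP[f [cf q'E]] qE]] hq]] alphaE]].
have r_ge n : alpha <= r n.
  by rewrite -lee_fin alphaE; apply: ereal_inf_lbound; exists n.
have r_lt e : 0 < e -> exists n, r n < alpha + e.
  move=> e0; have : (ereal_inf (range (fun n => (r n)%:E)) < (alpha + e)%:E)%E.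
    by rewrite -alphaE lte_fin ltrDl.
  by move=> /ereal_inf_lt[_ [n _ <-]]; rewrite lte_fin; exists n.
(* Starting at 1 yields [rho [::] = 1], and the decrease of [m] yields the semi-measure
   inequality. *)
pose fix m n := if n is n'.+1 then Num.min (m n') (r n') else 1.
have mS n : m n.+1 <= m n by rewrite /= ge_min lexx.
have m_ge n : alpha <= m n.
  elim: n => [|n IHn] /=; first by case/andP: alpha01.
  by rewrite le_min IHn r_ge.
have m_le1 n : m n <= 1 by elim: n => //= n; apply: le_trans; exact: mS.
have alpha0 : 0 <= alpha by case/andP: alpha01.
have p2 n : 0 < (2 : R) ^- n by rewrite invr_gt0 exprn_gt0.
pose rho (s : seq bool) := m (size s) * 2 ^- size s.
have rhobarE s : rhobar rho s = alpha * 2 ^- size s.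
  (* [rho] depends only on the length, and [s] has [2 ^ (n - size s)] extensions of length [n], so
     only the factor [m n] varies with [n]. *)
  have sumE n : (size s <= n)%N ->
      \sum_(t : n.-tuple bool | prefix s t) rho t = m n * 2 ^- size s.
    move=> le_s; under eq_bigr do rewrite /rho size_tuple.
    rewrite sum_tuple_prefix // -[LHS]mulr_natr natrX -mulrA; congr (_ * _).
    by rewrite -{1}(subnK le_s) exprD invfM mulrAC mulVf ?mul1r // expf_neq0.
  apply: inf_eq => [_ [n /sumE -> <-]|e e0]; first by rewrite ler_pM2r.
  have [i lt_i] := r_lt (e / 2 ^- size s) (divr_gt0 e0 (p2 _)).
  (* [m i.+1] is the first minimum that includes [r i], and the infimum ranges only over lengths at
     least [size s]. *)
  exists (m (maxn i.+1 (size s)) * 2 ^- size s).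
    by exists (maxn i.+1 (size s)); rewrite /= ?leq_maxr // sumE ?leq_maxr.
  rewrite -ltr_pdivlMr // mulrDl mulfK ?gt_eqF //.
  apply: le_lt_trans lt_i; apply: le_trans (_ : m i.+1 <= _).
    have /nonincreasing_seqP := mS; apply; exact: leq_maxl.
  by rewrite /= ge_min lexx orbT.
exists rho; split=> //; split; [split|].
- move=> s; have m0 := le_trans alpha0 (m_ge (size s)); have /ltW p0 := p2 (size s).
  rewrite /rho mulr_ge0 // mulr_ile1 // invf_le1 ?exprn_gt0 //.
  by rewrite exprn_ege1 // ler1n.
- by rewrite /rho /= expr0 invr1 mulr1.
- move=> s; rewrite /rho !size_rcons -mulrDr exprSr invfM -splitr.
  by rewrite ler_pM2r.
(* Stage [n] of [rho] at the string coded by [z]: each [r i] is replaced by its stage [q i n]. *)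
pose F n z := rdivn (rmins (fun i => f (cpair i n)) (str_size z)) (2 ^ str_size z).
exists (fun s n => rdec (F n (str_code s))); split.
  exists (fun z => rdec (F (csnd z) (cfst z))); split; last by move=> s n; rewrite !cpairK.
  apply/ratseq_computableP; exists (fun z => F (csnd z) (cfst z)); split=> //.
  have cs : computable_in empty_oracle (fun z => str_size (cfst z)).
    by apply: comp_str_size; computability.
  apply: comp_rdivn; last exact: comp_pow2.
  by apply: (@comp_rmins _ (fun z i => f (cpair i (csnd z)))) => //; computability.
move=> s; rewrite /F str_sizeE.
have rdecE n : rdec (rdivn (rmins (fun i => f (cpair i n)) (size s)) (2 ^ size s)) =
               rdec (rmins (fun i => f (cpair i n)) (size s)) / (2 ^ size s)%:R.
  by rewrite rdec_divn // expn_gt0.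
have fE i n : rdec (f (cpair i n)) = q i n by rewrite -q'E -qE.
split=> [n|].
  rewrite !rdecE ler_pM2r ?invr_gt0 ?ltr0n ?expn_gt0 //.
  elim: (size s) => [|k IHk]; first by rewrite !rdec_mins0.
  rewrite !rdec_minsS !fE le_min !ge_min IHk /=; have [-> _] := hq k.
  by rewrite orbT.
under eq_fun do rewrite rdecE fmorph_div /= ratr_nat natrX.
rewrite /rho; apply: cvgMr_tmp.
elim: (size s) => [|k IHk] /=.
  under eq_fun do rewrite rdec_mins0 rmorph1.
  exact: cvg_cst.
under eq_fun do rewrite rdec_minsS fE ratr_min.
by apply: cvg_min => //; have [] := hq k.
Qed.

Lemma semimeasure_jump_right_ce :
  (exists rho : seq bool -> R, left_ce_semimeasure rho /\
     forall s : seq bool, rhobar rho s = alpha * 2 ^- size s) ->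
  jump_right_ce alpha.
Proof.
move=> [rho [[[rho01 _ _] [q [[q' [/ratseq_computableP[f [cf q'E]] qE]] hq]]] rhobarE]].
pose S n := \sum_(t : n.-tuple bool) rho t.
have S_ge0 n : 0 <= S n by apply: sumr_ge0 => t _; case/andP: (rho01 t).
(* Every string extends [[::]], so this is the hypothesis on [rhobar] at the empty string. *)
have infS : inf (range S) = alpha.
  have := rhobarE [::]; rewrite /= expr0 invr1 mulr1 => <-; congr inf.
  rewrite predeqE => x; split=> [[n _ <-]|[n _ <-]]; exists n => //=;
    by apply: eq_bigl => t; rewrite prefix0s.
have lbS : lbound (range S) 0 by move=> _ [n _ <-].
have S_ge n : alpha <= S n.
  by rewrite -infS; apply: ge_inf; [exists 0|exists n].
have S_lt e : 0 < e -> exists n, S n < alpha + e.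
  move=> e0; have [|_ [n _ <-]] := @inf_adherent R (range S) e e0.
    by split; [exists (S 0%N); exists 0%N|exists 0].
  by rewrite infS; exists n.
(* Stage [N] of [S n], summed over the codes of the strings of length [n]. *)
pose T n N := rsum (fun j => f (cpair (2 ^ n + j) N)) (2 ^ n).
have TE n N : rdec (T n N) = \sum_(t : n.-tuple bool) q t N.
  rewrite /T rdec_sum -(sum_str_code n (fun x => rdec (f (cpair x N)))).
  by apply: eq_bigr => t _; rewrite -q'E -qE.
have T_mono n N : rdec (T n N) <= rdec (T n N.+1).
  by rewrite !TE; apply: ler_sum => t _; have [h _] := hq t; exact: h.
have T_cvg n : (ratr (rdec (T n N)) : R) @[N --> \oo] --> S n.
  under eq_fun do rewrite TE rmorph_sum.
  apply: cvg_big => [|t _]; first exact: add_continuous.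
  by have [] := hq t.
have T_le n N : ratr (rdec (T n N)) <= S n.
  by apply: nondecreasing_cvg_le (T_cvg n) N => N; rewrite ratr_le.
pose k2r j k := cpair k (cpair 0 j).
have k2rE j k : ratr (rdec (k2r j k)) = k%:R / j.+1%:R :> R.
  by rewrite /rdec /rat_of_nats !cpairK subr0 fmorph_div /= !ratr_nat.
have cT A : computable_in A (fun z => T (cfst z) (csnd z)).
  have cf' := computable_relative A cf.
  apply: (@comp_rsum _ (fun z j => f (cpair (2 ^ cfst z + j) (csnd z)))).
    by computability; apply: comp_pow2; computability.
  by apply: comp_pow2; computability.
(* For [x] coding [((n, j), k)], a zero of [g x] is a stage at which the approximation to [S n]
   exceeds [k / (j + 1)]; by [smn], one oracle question decides whether such a stage exists. *)
pose g x N : nat := rle (T (cfst (cfst x)) N) (k2r (csnd (cfst x)) (csnd x)).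
have [e [ce eE]] : exists e, computable e /\
    forall x, halting_set (e x) <-> exists N, g x N = 0%N.
  apply: smn; apply: comp_rle; last by rewrite /k2r; computability.
  by apply: (@comp_app2 _ T) => //; computability.
pose P i k := S (cfst i) <= k%:R / (csnd i).+1%:R.
(* The stages increase to [S n], so a strict inequality [k / (j + 1) < S n] is visible at some
   finite stage, and only then. *)
have haltP i k : halting_set (e (cpair i k)) <-> ~~ P i k.
  rewrite eE /g /P !cpairK -ltNge; split=> [[N /eqP]|lt_S].
    rewrite eqb0 rleE -ltNge -(ltr_rat R) k2rE => lt_T.
    exact: lt_le_trans lt_T (T_le _ _).
  have [N lt_N] := cvg_near_gt (T_cvg (cfst i)) lt_S; exists N.
  by apply/eqP; rewrite eqb0 rleE -ltNge -(ltr_rat R) k2rE.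
have exP i : exists k, P i k.
  exists (Num.truncn (S (cfst i) * (csnd i).+1%:R)).+1.
  by rewrite /P ler_pdivlMr ?ltr0Sn // ltW // truncnS_gt.
pose m i := ex_minn (exP i).
have mP i : P i (m i) by rewrite /m; case: ex_minnP.
have m_min i k : (k < m i)%N -> ~~ P i k.
  by rewrite /m; case: ex_minnP => v _ h; rewrite ltnNge; apply: contraNN => /h.
have cm : computable_in halting_set m.
  (* The oracle answers 0 on [e (cpair i k)] exactly when [P i k] holds, so unbounded search finds
     the least such [k]. *)
  apply: (@comp_mu _ (fun i k => `[< halting_set (e (cpair i k)) >] : nat)).
    apply: (@comp_oracle _ _ (fun x => `[< halting_set x >])).
      by move=> x; split => /asboolP.
    by apply: (comp_comp (computable_relative _ ce)); computability.
  move=> i; split=> [|k /m_min nP].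
    by case: asboolP => // /haltP; rewrite mP.
  by case: asboolP => // -[]; apply/haltP.
pose p i := k2r (csnd i) (m i).
have p_ge i : alpha <= ratr (rdec (p i)).
  by rewrite k2rE; apply: le_trans (S_ge (cfst i)) (mP i).
(* By minimality the predecessor of a positive [m (cpair n j)] fails, which limits the error to
   [1 / (j + 1)]; if the minimum is 0, [S n >= 0] suffices. *)
have p_lt n j : ratr (rdec (p (cpair n j))) <= S n + j.+1%:R^-1.
  rewrite k2rE cpairK; case Em: (m (cpair n j)) => [|k].
    by rewrite mul0r addr_ge0 // invr_ge0 ler0n.
  have := m_min (cpair n j) k; rewrite Em ltnSn => /(_ isT).
  rewrite /P !cpairK -ltNge => /ltW le_k.
  by rewrite -natr1 mulrDl mul1r lerD2r.
(* The upper bounds [p i] come in no particular order; their running minimum is non-increasing. *)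
exists (fun n => rdec (rmins p n)); split; [|split].
- apply/ratseq_computableP; exists (rmins p); split=> //.
  apply: (@comp_rmins _ (fun _ i => p i)); last exact: comp_id.
  by rewrite /p /k2r; computability.
- by move=> n; rewrite rdec_minsS ge_min lexx.
apply: nonincreasing_cvg_inf => [n|n|d d0].
- by rewrite ratr_le rdec_minsS ge_min lexx.
- have [->|[i _ ->]] := rdec_mins_attained p n; last exact: p_ge.
  by rewrite rmorph1; case/andP: alpha01.
have [n lt_n] := S_lt (d / 2) (divr_gt0 d0 (ltr0Sn _ 1)).
have [j lt_j] : exists j, j.+1%:R^-1 < d / 2.
  exists (Num.truncn (d / 2)^-1); rewrite invf_plt ?posrE ?ltr0Sn ?divr_gt0 //.
  by rewrite truncnS_gt.
(* The successor, because [rmins p n] ranges over indices strictly below [n]. *)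
exists (cpair n j).+1.
apply: le_lt_trans (_ : ratr (rdec (p (cpair n j))) < _).
  by rewrite ratr_le; apply: rdec_mins_le.
by apply: le_lt_trans (p_lt n j) _; rewrite (splitr d) addrA ltrD.
Qed.

End SemimeasureImplications.

Theorem theorem6p6 (R : realType) (alpha : R) (ha : 0 <= alpha <= 1) :
  [<-> jump_right_ce alpha;
       exists q : nat -> rat, ratseq_computable q /\
         alpha%:E = limn_esup (fun n => (ratr (q n) : R)%:E);
       exists r : nat -> R, uniform_left_ce r /\
         alpha%:E = ereal_inf (range (fun n => (r n)%:E));
       exists rho : seq bool -> R, left_ce_semimeasure rho /\
         forall s : seq bool, rhobar rho s = alpha * 2 ^- size s].
Proof.
tfae.
- exact: jump_right_ce_limsup.
- exact: limsup_inf.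
- exact: inf_semimeasure.
- exact: semimeasure_jump_right_ce.
Qed.
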